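(* Let $\overline{K}=(K_1,\ldots,K_n)$ be a vector of strikes. Then $$V_{f_{AB}}=\sum_{i=1}^n\int_0^T\int_0^\infty\cdots\int_0^\infty (x_i-K_i)^+\ \frac{\partial^n}{\partial x_1\cdots\partial x_n}\left(\sum_{j=1}^n\frac{\partial}{\partial x_j}V_{f_{ML}}\big(t,t+s,(x_1,\ldots,x_n)\big)\Big|_{s=0^+}\right)\prod_{k=1}^n dx_k\ dt ,$$ where the partial derivatives exist almost everywhere.
   Context: $\mathbb{Q}$ is a probability (pricing) measure, the interest rate is $0$, and $V_f=\mathbb{E}_{\mathbb{Q}}f$ denotes the price of a payoff $f$. $\overline{S}_t=(S^{(1)}_t,\ldots,S^{(n)}_t)$, also written $S_i(t)=S^{(i)}_t$, are $n$ stock price processes with values in $(0,\infty)$; for each $i$, $\max_t S^{(i)}_t$ exists a.s. and has finite $\mathbb{Q}$-expectation. It is assumed that there is a measure $\mu\ll m_{n+1}$ (Lebesgue measure) on $[0,T]\times(0,\infty)^n$ given by $$\frac{d\mu}{dm_{n+1}}(t,K_1,\ldots,K_n)=\frac{\partial^n}{\partial K_1\cdots\partial K_n}\mathbb{Q}\Big(\bigwedge_{i}S^{(i)}_t\le K_i\Big),$$ i.e. the joint law of $\overline{S}_t$ is absolutely continuous with this density for a.e. $t$. The multi-asset look-back and Asian basket payoffs are $$f_{ML}(T_0,T_1,\overline{K})=\max_{T_0\le t\le T_1,\ 1\le i\le n}(S_i(t)-K_i)^+,\qquad f_{AB}(T,\overline{K})=\int_0^T\sum_{i=1}^n(S_i(t)-K_i)^+\,dt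 .$$ The notation $\big|_{s=0^+}$ denotes the limit as $s\to0^+$.
   Formalization: The stock price paths are additionally assumed almost surely right-continuous on [0,T); without path regularity the formula fails, e.g. for S_t = U at irrational t and U+1 at rational t. *)

(* Defs.v *)
From HB Require Import structures.
From mathcomp Require Import all_boot all_order all_algebra.
From mathcomp Require Import all_classical all_reals all_analysis.

Set Implicit Arguments.
Unset Strict Implicit.
Unset Printing Implicit Defensive.

Import Order.TTheory GRing.Theory Num.Theory.
Import numFieldNormedType.Exports.

Local Open Scope classical_set_scope.
Local Open Scope ring_scope.

(** * Lebesgue measure on R^n

    Vectors of R^n are [n.-tuple R], which the library equips with the product
    (hence Borel) sigma-algebra.  The Lebesgue measure on R^(n+1) is the product
    of the one on R and the one on R^n. *)

Fixpoint lebesgue_tuple (R : realType) (n : nat) :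
    set (n.-tuple R) -> \bar R :=
  match n with
  | 0 => fun A => \d_([tuple]) A
  | m.+1 => fun A =>
      (@lebesgue_measure R \x @lebesgue_tuple R m)%E
        [set p : R * m.-tuple R | A [tuple of p.1 :: p.2]]
  end.

Definition orthant (R : realType) (n : nat) : set (n.-tuple R) :=
  [set x | forall i, 0 < tnth x i].

(** * Functions defined only almost everywhere

    For s > 0, the price of a look-back option need not be differentiable in
    the strikes everywhere, and the exceptional null set may change with s.  The
    iterated partial derivatives are therefore taken of functions with a domain;
    limits run over the indices at which the function is defined. *)

Record pfun (R : realType) (V : Type) : Type := PFun {
  pdom : set V ;
  pval :> V -> R
}.

Definition ptotal (R : realType) (V : Type) (f : V -> R) : pfun R V :=
  PFun setT f.

(** Pointwise limit of [u i] along the filter [F]: it is defined at [x] when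
    [x] lies in the domain of [u i] for indices [i] arbitrarily far along [F]
    ([ProperFilter]) and the limit along these indices exists. *)
Definition plim (R : realType) (V I : Type) (F : set_system I)
    (u : I -> pfun R V) : pfun R V :=
  let Fx x := within [set i | pdom (u i) x] F in
  PFun [set x | ProperFilter (Fx x) /\ cvg (u i x @[i --> Fx x])]
       (fun x => lim (u i x @[i --> Fx x])).

Definition psum (R : realType) (V : Type) (n : nat) (f : 'I_n -> pfun R V) :
    pfun R V :=
  PFun [set x | forall j, pdom (f j) x] (fun x => \sum_(j < n) f j x).

(** [shiftc j h x] is x + h e_j. *)
Definition shiftc (R : realType) (n : nat) (j : 'I_n) (h : R)
    (x : n.-tuple R) : n.-tuple R :=
  [tuple if i == j then tnth x i + h else tnth x i | i < n].

Definition pderiv (R : realType) (n : nat) (j : 'I_n)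
    (f : pfun R (n.-tuple R)) : pfun R (n.-tuple R) :=
  plim (0 : R)^' (fun h : R =>
    PFun [set x | pdom f x /\ pdom f (shiftc j h x)]
         (fun x => h^-1 * (f (shiftc j h x) - f x))).

(** d/dx_1 (d/dx_2 ( ... (d/dx_n f))) *)
Definition mixed_pderiv (R : realType) (n : nat) (f : pfun R (n.-tuple R)) :
    pfun R (n.-tuple R) :=
  foldr (@pderiv R n) f (enum 'I_n).

Lemma shiftc0 (R : realType) (n : nat) (j : 'I_n) (x : n.-tuple R) :
  shiftc j 0 x = x.
Proof.
by apply: eq_from_tnth => i; rewrite tnth_mktuple addr0; case: ifP.
Qed.

Lemma quotient_total (R : realType) (n : nat) (j : 'I_n)
    (f : n.-tuple R -> R) (x : n.-tuple R) :
  (fun h : R => h^-1 * (f (shiftc j h x) - f x)) =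
  (fun h : R => h^-1 *: (f (shiftc j (h + 0) x) - f (shiftc j 0 x))).
Proof. by apply/funext => h; rewrite addr0 shiftc0. Qed.

Lemma within_total (R : realType) (F : set_system R) :
  within [set i : R | True /\ True] F = F.
Proof.
apply/funext => A; rewrite /within/=; congr (F _).
by apply/funext => i; apply/propext; split=> [|? _]//; apply.
Qed.

(** On everywhere defined functions, [pderiv] is the library's derivative of
    the restriction to the j-th coordinate line. *)
Lemma pdom_pderiv_total (R : realType) (n : nat) (j : 'I_n)
    (f : n.-tuple R -> R) (x : n.-tuple R) :
  pdom (pderiv j (ptotal f)) x <-> derivable (fun h : R => f (shiftc j h x)) 0 1.
Proof.
rewrite /pderiv /plim /= within_total quotient_total /derivable /=.
have -> : (fun h : R => h^-1 *: (f (shiftc j (h *: (1 : R) + 0) x) -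
    f (shiftc j 0 x))) =
    (fun h : R => h^-1 *: (f (shiftc j (h + 0) x) - f (shiftc j 0 x))).
  by apply/funext => h; rewrite [h *: _]mulr1.
by split=> [[]|] //; split=> //; exact: Proper_dnbhs_numFieldType.
Qed.

Lemma pderiv_totalE (R : realType) (n : nat) (j : 'I_n)
    (f : n.-tuple R -> R) (x : n.-tuple R) :
  pderiv j (ptotal f) x = derive1 (fun h : R => f (shiftc j h x)) 0.
Proof.
by rewrite /pderiv /plim /= within_total quotient_total.
Qed.

(** * The market *)

Section market.
Context d (Omega : measurableType d) (R : realType) (Q : probability Omega R).
Context (n : nat) (S : 'I_n -> R -> {RV Q >-> R}).
Implicit Types (t T : R) (K x : n.-tuple R) (w : Omega).

Definition stocks t w : n.-tuple R := [tuple S i t w | i < n].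

Definition joint_cdf t : n.-tuple R -> R :=
  fun K => fine (Q [set w | forall i, S i t w <= tnth K i]).

(** The maxima are written as suprema, which are equal to them whenever they
    are attained. *)
Definition running_max T (i : 'I_n) w : R := sup [set S i t w | t in `[0, T]].

Definition f_ML (T0 T1 : R) K w : R :=
  sup [set y | exists i t, t \in `[T0, T1] /\
                           y = Num.max (S i t w - tnth K i) 0].

Definition f_AB T K w : R :=
  \int[@lebesgue_measure R]_(t in `[0, T])
    (\sum_(i < n) Num.max (S i t w - tnth K i) 0).

Definition V_ML (T0 T1 : R) K : R := fine ('E_Q[f_ML T0 T1 K])%E.

Definition V_AB T K : \bar R := ('E_Q[f_AB T K])%E.

(** sum_j d/dx_j V_ML(t, t+s, x) |_{s = 0+} *)
Definition dV_ML t : pfun R (n.-tuple R) :=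
  plim (0 : R)^'+ (fun s =>
    psum (fun j => pderiv j (ptotal (V_ML t (t + s))))).

(** The joint law of the stocks at time t is absolutely continuous, with
    density the n-th mixed partial derivative of its distribution function. *)
Definition has_cdf_density t : Prop :=
  exists rho : n.-tuple R -> R,
    [/\ measurable_fun setT rho, (forall x, 0 <= rho x),
        (forall A : set (n.-tuple R), measurable A ->
           Q [set w | A (stocks t w)] =
           \int[@lebesgue_tuple R n]_(x in A `&` @orthant R n) (rho x)%:E)%E
      & {ae @lebesgue_tuple R n, forall x, orthant x ->
           pdom (mixed_pderiv (ptotal (joint_cdf t))) x /\
           mixed_pderiv (ptotal (joint_cdf t)) x = rho x}].

End market.

(* Main.v *)
(** Write M_i for the maximum of S_i over [t, t+s], so that the look-back payoff is
    max(0, max_i (M_i - x_i)).  As a function of x_j it is piecewise linear; the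
    one-sided derivatives of its price are minus the probabilities that stock j
    is the strict, resp. weak, winner of this maximum.  If all partial derivatives
    exist they sum to Q(M_i <= x_i for all i) - 1, and they exist as soon as x_j is
    not an atom of M_j and x_i - x_j is not an atom of M_i - M_j.  By
    right-continuity the sum tends to F_t(x) - 1 as s -> 0+, where F_t is the joint
    distribution function.

    It remains to recover the density rho of the law at time t as the iterated
    partial derivative of F_t restricted to a set that is only known to contain
    the generic points.  For a.e. values of the last coordinates the derivative in
    these coordinates is shown to be the integral of rho over the remaining
    lower set for ALL values of the remaining coordinates (Lebesgue
    differentiation at rational values, monotonicity, and continuity in the
    remaining coordinates), so no partial limit can be wrong.  The formula for the
    Asian basket is then Tonelli's theorem. *)

From HB Require Import structures.
From mathcomp Require Import all_boot all_order all_algebra.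
From mathcomp Require Import all_classical all_reals all_analysis.
From mathcomp Require Import measurable_realfun ring lra.
Require Import Defs.

Set Implicit Arguments.
Unset Strict Implicit.
Unset Printing Implicit Defensive.

Import Order.TTheory GRing.Theory Num.Theory.
Import numFieldNormedType.Exports.

Local Open Scope classical_set_scope.
Local Open Scope ring_scope.

(** * Integrals and Lebesgue measure on tuples *)

(** Lebesgue differentiation costs one null set per integrand, while the inner derivatives leave
    behind integrands indexed by uncountably many upper limits. The induction therefore carries a
    whole family of densities with a countable subfamily that squeezes every member off a single
    null set. This invariant, [sandwiched], survives integrating out a coordinate because
    nonnegative integrands make the integral monotone in its upper limit.

    Two claims are kept apart: the value of the iterated derivative wherever it is defined, and the
    fact that it is defined. For the second, a set [E] of good points is carried along such that
    almost every displacement of a good point along any coordinate axis is good again. Full measure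
    of [E] alone would say nothing about a prescribed line, and without good displacements close to
    0 a partial limit could lack a proper filter.

    The iterated derivative is not shown to be measurable, which is why integrands are exchanged
    through [ae_eq_integral_nomeas]. *)

Section ae_tools.
Context d (T : measurableType d) (R : realType).
Variable mu : {measure set T -> \bar R}.

Lemma aeS (P Q : T -> Prop) : (forall x, P x -> Q x) ->
  {ae mu, forall x, P x} -> {ae mu, forall x, Q x}.
Proof. by move=> PQ; apply: filterS => x; exact: PQ. Qed.

Lemma aeS2 (P P' Q : T -> Prop) : (forall x, P x -> P' x -> Q x) ->
  {ae mu, forall x, P x} -> {ae mu, forall x, P' x} -> {ae mu, forall x, Q x}.
Proof. by move=> PQ; apply: filterS2 => x; exact: PQ. Qed.

Lemma ae_forall_nat (P : nat -> T -> Prop) :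
  (forall k, {ae mu, forall x, P k x}) -> {ae mu, forall x, forall k, P k x}.
Proof.
move=> aeP; apply: negligibleS (negligible_bigcup aeP) => x /= /existsNP[k Pk].
by exists k.
Qed.

Lemma ae_forall_countType (I : countType) (P : I -> T -> Prop) :
  (forall i, {ae mu, forall x, P i x}) -> {ae mu, forall x, forall i, P i x}.
Proof.
move=> aeP.
have : {ae mu, forall x, forall k, if unpickle k is Some i then P i x else True}.
  apply: ae_forall_nat => k; case: unpickle => [i|]; first exact: aeP.
  exact: aeW.
by apply: aeS => x h i; have := h (pickle i); rewrite pickleK.
Qed.

End ae_tools.

Section ae_integral.
Context d (T : measurableType d) (R : realType).
Variable mu : {measure set T -> \bar R}.
Local Open Scope ereal_scope.
Import HBNNSimple.

Lemma ereal_sup_sintegral_ae_le (f g : T -> \bar R) :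
    (forall x, 0 <= g x) -> {ae mu, forall x, f x = g x} ->
  ereal_sup [set sintegral mu h |
    h in [set h : {nnsfun T >-> R} | forall x, (h x)%:E <= f x]] <=
  ereal_sup [set sintegral mu h |
    h in [set h : {nnsfun T >-> R} | forall x, (h x)%:E <= g x]].
Proof.
move=> g0 [N [mN N0 fgN]]; apply: ge_ereal_sup => _ [h /= hf <-].
have mNC : measurable (~` N) by exact: measurableC.
apply: ereal_sup_ubound; exists (proj_nnsfun h mNC) => /=.
  move=> x; have := mrestrict h mNC => /(congr1 (@^~ x)) /= <-; rewrite patchE.
  case: ifPn => [/set_mem xN|//]; have <- : f x = g x; last exact: hf.
  by apply: contrapT => ?; apply: xN; exact: fgN.
have E (k : {nnsfun T >-> R}) : sintegral mu k = \int[mu]_x (k x)%:E.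
  by rewrite (integral_nnsfun mu measurableT) patch_setT.
rewrite (E (proj_nnsfun h mNC)) E.
apply: ae_eq_integral => //.
- by apply/measurable_EFinP; exact: measurable_funPT.
- by apply/measurable_EFinP; exact: measurable_funPT.
exists N; split => // x /=; apply: contra_notP => xN _.
have := mrestrict h mNC => /(congr1 (@^~ x)) /= <-.
by rewrite patchE mem_set.
Qed.

(* The integral of an arbitrary function is a supremum over simple functions, so
   no measurability is needed: a simple function below [f] may be cut off on the
   exceptional null set. *)
Lemma ae_eq_integral_nomeas (D : set T) (f g : T -> \bar R) :
  {ae mu, forall x, D x -> f x = g x} ->
  \int[mu]_(x in D) f x = \int[mu]_(x in D) g x.
Proof.
move=> fg; rewrite /integral.
have fgD : {ae mu, forall x, (f \_ D) x = (g \_ D) x}.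
  move: fg; apply: filterS => x /= fgx; rewrite !patchE.
  by case: ifPn => // /set_mem /fgx.
congr (_ - _); apply/eqP; rewrite eq_le; apply/andP; split;
  apply: ereal_sup_sintegral_ae_le => //; move: fgD; apply: filterS => x /= h;
  by rewrite ?funeposE ?funenegE h.
Qed.

End ae_integral.

Section tuple_measure.
Context (R : realType).
Local Open Scope ereal_scope.

Definition tcons n (p : measurableTypeR R * n.-tuple R) : n.+1.-tuple R :=
  [tuple of p.1 :: p.2].
Definition tuncons n (x : n.+1.-tuple R) : measurableTypeR R * n.-tuple R :=
  (thead x, [tuple of behead x]).

Lemma tconsK n : cancel (@tcons n) (@tuncons n).
Proof. by case=> x z; congr pair; apply: val_inj. Qed.

Lemma tunconsK n : cancel (@tuncons n) (@tcons n).
Proof. by move=> x; rewrite [RHS]tuple_eta; apply: val_inj. Qed.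

Lemma measurable_tcons n : measurable_fun setT (@tcons n).
Proof. exact: measurable_cons. Qed.

Lemma measurable_tuncons n : measurable_fun setT (@tuncons n).
Proof.
apply/measurable_fun_pairP; split => /=; last exact: measurable_behead.
exact: measurable_tnth.
Qed.

Lemma lebesgue_tupleS n (A : set (n.+1.-tuple R)) :
  lebesgue_tuple A = (@lebesgue_measure R \x @lebesgue_tuple R n) (@tcons n @^-1` A).
Proof. by []. Qed.

(** The properties are proved in one induction: [lebesgue_tuple] is a bare set function, and its
    product with Lebesgue measure can be treated as a measure only after the lower-dimensional one
    has been packed as a sigma-finite measure. *)
Lemma lebesgue_tuple_measure_axioms n :
  [/\ @lebesgue_tuple R n set0 = 0, (forall A, 0 <= @lebesgue_tuple R n A),
      semi_sigma_additive (@lebesgue_tuple R n) &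
      sigma_finite setT (@lebesgue_tuple R n)].
Proof.
elim: n => [|n [l0 l_ge0 l_add l_sf]].
  by split; [exact: measure0|move=> A; exact: measure_ge0|
    exact: measure_semi_sigma_additive|exact: sigma_finiteT].
pose mu1 : {measure set _ -> \bar R} :=
  HB.pack (@lebesgue_tuple R n) (isMeasure.Build _ _ _ _ l0 l_ge0 l_add).
pose mu : {sigma_finite_measure set _ -> \bar R} :=
  HB.pack (@lebesgue_tuple R n) (Measure.class mu1)
    (Measure_isSigmaFinite.Build _ _ _ mu1 l_sf).
pose nu0 := @lebesgue_tuple R n.+1.
have nu0E A : nu0 A = (@lebesgue_measure R \x mu) (@tcons n @^-1` A) by [].
split.
- by rewrite -/nu0 nu0E preimage_set0 (measure0 (@lebesgue_measure R \x mu)%E).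
- by move=> A; rewrite -/nu0 nu0E; exact: (measure_ge0 (@lebesgue_measure R \x mu)%E).
- move=> F mF tF mUF; rewrite -/nu0 [X in _ --> X]nu0E preimage_bigcup.
  apply: measure_semi_sigma_additive.
  - by move=> k; rewrite -[X in measurable X]setTI; exact: measurable_tcons.
  - by apply/trivIsetP => /= i j _ _ ij; rewrite -preimage_setI;
       move/trivIsetP : tF => /(_ i j Logic.I Logic.I ij) ->; rewrite preimage_set0.
  - by rewrite -preimage_bigcup -[X in measurable X]setTI; exact: measurable_tcons.
- have /sigma_finiteP[F [FT ndF Foo]] := sigma_finiteT (@lebesgue_measure R).
  have /sigma_finiteP[G [GT ndG Goo]] := sigma_finiteT mu.
  (* Both exhaustions are nondecreasing, so the diagonal products already cover the whole
     product. *)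
  exists (fun k => @tuncons n @^-1` (F k `*` G k)).
    rewrite -preimage_bigcup; apply/esym/seteqP; split => // x _.
    have [i _ Fi] : (\bigcup_k F k) (tuncons x).1 by rewrite -FT.
    have [j _ Gj] : (\bigcup_k G k) (tuncons x).2 by rewrite -GT.
    exists (maxn i j) => //; split.
      by move: Fi; exact/subsetPset/ndF/leq_maxl.
    by move: Gj; exact/subsetPset/ndG/leq_maxr.
  move=> k; have [? ?] := Foo k; have [? ?] := Goo k; split.
    by rewrite -[X in measurable X]setTI; apply: measurable_tuncons => //;
       exact: measurableX.
  rewrite -/nu0 nu0E; set A := (X in _ X < _).
  have -> : A = F k `*` G k by apply/funext => p; rewrite /A /preimage /mkset tconsK.
  by rewrite product_measure1E// lte_mul_pinfty// ge0_fin_numE.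
Qed.

Lemma lebesgue_tuple0 n : @lebesgue_tuple R n set0 = 0.
Proof. by have [] := lebesgue_tuple_measure_axioms n. Qed.

Lemma lebesgue_tuple_ge0 n A : 0 <= @lebesgue_tuple R n A.
Proof. by have [] := lebesgue_tuple_measure_axioms n. Qed.

Lemma lebesgue_tuple_semi_sigma_additive n :
  semi_sigma_additive (@lebesgue_tuple R n).
Proof. by have [] := lebesgue_tuple_measure_axioms n. Qed.

HB.instance Definition _ n := isMeasure.Build _ _ _ (@lebesgue_tuple R n)
  (@lebesgue_tuple0 n) (@lebesgue_tuple_ge0 n)
  (@lebesgue_tuple_semi_sigma_additive n).

Lemma lebesgue_tuple_sigma_finite n : sigma_finite setT (@lebesgue_tuple R n).
Proof.
by have [] := lebesgue_tuple_measure_axioms n.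
Qed.

HB.instance Definition _ n := Measure_isSigmaFinite.Build _ _ _
  (@lebesgue_tuple R n) (@lebesgue_tuple_sigma_finite n).

(** In dimension [n.+1] the measure is, by conversion, the push-forward of the product measure along
    [tcons]. *)
Lemma ge0_integral_lebesgue_tupleS n (f : n.+1.-tuple R -> \bar R) :
  measurable_fun setT f -> (forall x, 0 <= f x) ->
  \int[@lebesgue_tuple R n.+1]_x f x =
  \int[@lebesgue_measure R \x @lebesgue_tuple R n]_p f (tcons p).
Proof.
move=> mf f0.
pose mu : {measure set _ -> \bar R} := (@lebesgue_measure R \x @lebesgue_tuple R n).
rewrite -[LHS]/(\int[pushforward mu (@tcons n)]_x f x).
have := @ge0_integral_pushforward _ _ _ _ R _ (@measurable_tcons n) mu setT f.
by rewrite preimage_setT; apply.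
Qed.

Lemma lebesgue_tupleS_ysection n (A : set (measurableTypeR R * n.-tuple R)) : measurable A ->
  (@lebesgue_measure R \x @lebesgue_tuple R n) A =
  \int[@lebesgue_tuple R n]_z lebesgue_measure (ysection A z).
Proof.
move=> mA.
have := @fubini_tonelli2 _ _ _ _ R (@lebesgue_measure R) (@lebesgue_tuple R n) (EFin \o \1_A).
rewrite integral_indic// setIT => ->//.
- apply: eq_integral => z _; rewrite /fubini_G/= -[in RHS](setIT (ysection A z)).
  rewrite -integral_indic//; last exact: measurable_ysection.
  by apply: eq_integral => x _ /=; rewrite !indicE mem_ysection.
- by apply/measurable_EFinP; exact: measurable_indic.
- by move=> x; rewrite lee_fin.
Qed.

End tuple_measure.

Section tuple_null_sets.
Context (R : realType).
Local Open Scope ereal_scope.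
Implicit Types n : nat.

Lemma tnth_tcons0 n x (z : n.-tuple R) : tnth (tcons (x, z)) ord0 = x.
Proof. by []. Qed.

Lemma tnth_tconsS n x (z : n.-tuple R) i :
  tnth (tcons (x, z)) (lift ord0 i) = tnth z i.
Proof. by rewrite tnthS. Qed.

Lemma tcons_ind n (P : n.+1.-tuple R -> Prop) :
  (forall x z, P (tcons (x, z))) -> forall x, P x.
Proof. by move=> h x; rewrite -(tunconsK x); case: (tuncons x). Qed.

Lemma eq_tcons n (x : n.+1.-tuple R) y z :
  tnth x ord0 = y -> (forall i, tnth x (lift ord0 i) = tnth z i) ->
  x = tcons (y, z).
Proof.
move=> xy xz; apply: eq_from_tnth => i.
by case: (unliftP ord0 i) => [j|] ->; rewrite ?tnth_tconsS ?xz ?xy.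
Qed.

Lemma shiftc_tcons0 n h x (z : n.-tuple R) :
  shiftc ord0 h (tcons (x, z)) = tcons ((x + h)%R, z).
Proof. by apply: eq_tcons => [|i]; rewrite tnth_mktuple// tnth_tconsS. Qed.

Lemma shiftc_tconsS n j h x (z : n.-tuple R) :
  shiftc (lift ord0 j) h (tcons (x, z)) = tcons (x, shiftc j h z).
Proof.
apply: eq_tcons => [|i]; rewrite !tnth_mktuple// (inj_eq lift_inj).
by rewrite tnth_tconsS.
Qed.

Lemma ge0_integral_lebesgue_tuple_head n (f : n.+1.-tuple R -> \bar R) :
  measurable_fun setT f -> (forall x, 0 <= f x) ->
  \int[@lebesgue_tuple R n.+1]_x f x =
  \int[@lebesgue_tuple R n]_z \int[@lebesgue_measure R]_x f (tcons (x, z)).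
Proof.
move=> mf f0; rewrite ge0_integral_lebesgue_tupleS//.
rewrite (fubini_tonelli2 (f \o @tcons R n)) //; last first.
  by move=> ?; exact: f0.
by apply: measurableT_comp => //; exact: measurable_tcons.
Qed.

Lemma ae_tuple_tail n (P : n.-tuple R -> Prop) :
  {ae @lebesgue_tuple R n, forall z, P z} ->
  {ae @lebesgue_tuple R n.+1, forall x, P (tuncons x).2}.
Proof.
move=> [N [mN N0 PN]].
exists (@tuncons R n @^-1` (setT `*` N)); split.
- rewrite -[X in measurable X]setTI; apply: measurable_tuncons => //.
  exact: measurableX.
- rewrite lebesgue_tupleS.
  have -> : @tcons R n @^-1` (@tuncons R n @^-1` (setT `*` N)) = setT `*` N.
    by apply/funext => p; rewrite /preimage /mkset tconsK.
  by rewrite product_measure1E// [X in _ * X](_ : _ = 0) ?mule0.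
- by move=> x Px; split => //; apply: PN.
Qed.

Lemma ae_tuple_section n (P : n.+1.-tuple R -> Prop) :
  {ae @lebesgue_tuple R n.+1, forall x, P x} ->
  {ae @lebesgue_tuple R n, forall z,
    {ae @lebesgue_measure R, forall x, P (tcons (x, z))}}.
Proof.
move=> [N [mN N0 PN]]; pose A := @tcons R n @^-1` N.
have mA : measurable A.
  by rewrite -[X in measurable X]setTI; exact: measurable_tcons.
move: N0; rewrite lebesgue_tupleS -/A lebesgue_tupleS_ysection// => A0.
have : \int[@lebesgue_tuple R n]_z `| lebesgue_measure (ysection A z) | = 0.
  by rewrite -[RHS]A0; apply: eq_integral => z _; rewrite gee0_abs.
move=> /ae_eq_integral_abs => /(_ measurableT (measurable_fun_ysection _ mA)).
apply: filterS => z /(_ Logic.I) Az; exists (ysection A z); split => //.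
- exact: measurable_ysection.
- by move=> x /= Px; rewrite /ysection/= inE; exact: PN.
Qed.

(** Measurability of [A] is what allows this converse of [ae_tuple_section]: null sections alone do
    not make a set null. *)
Lemma ae_tuple_of_section n (A : set (measurableTypeR R * n.-tuple R)) :
  measurable A ->
  {ae @lebesgue_tuple R n, forall z, {ae @lebesgue_measure R, forall x, A (x, z)}} ->
  {ae @lebesgue_tuple R n.+1, forall x, A (tuncons x)}.
Proof.
move=> mA Aae; exists (~` (@tuncons R n @^-1` A)); split => //.
  apply: measurableC; rewrite -[X in measurable X]setTI.
  exact: measurable_tuncons.
rewrite lebesgue_tupleS.
have -> : @tcons R n @^-1` (~` (@tuncons R n @^-1` A)) = ~` A.
  by apply/funext => p; rewrite /preimage /setC /mkset tconsK.
rewrite lebesgue_tupleS_ysection; last exact: measurableC.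
rewrite (ae_eq_integral_nomeas (g := cst 0)) ?integral0//.
apply: filterS Aae => z [N [mN N0 AN]] _ /=.
apply/eqP; rewrite eq_le measure_ge0 andbT -N0; apply: le_measure.
- by rewrite inE; apply: measurable_ysection; exact: measurableC.
- by rewrite inE.
- by move=> x; rewrite /ysection/= inE => ?; exact: AN.
Qed.

(** Tonelli with coordinate [j] integrated first; the induction peels off coordinates until [j] is
    the head. *)
Lemma lebesgue_tuple_lines0 n (j : 'I_n) (A : set (n.-tuple R)) : measurable A ->
  (forall x, (@lebesgue_measure R).-negligible [set h | A (shiftc j h x)]) ->
  lebesgue_tuple A = 0.
Proof.
elim: n j A => [[]//|n IH] j A mA A0.
pose B := @tcons R n @^-1` A.
have mB : measurable B.
  by rewrite -[X in measurable X]setTI; exact: measurable_tcons.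
rewrite lebesgue_tupleS -/B; case: (unliftP ord0 j) A0 => [i|] -> A0; last first.
  rewrite lebesgue_tupleS_ysection// integral0_eq// => z _.
  apply: measure_negligible; first exact: measurable_ysection.
  apply: negligibleS (A0 (tcons (0%R, z))) => x.
  by rewrite /ysection/= inE shiftc_tcons0 add0r.
rewrite /product_measure1 integral0_eq// => x _ /=.
apply: (IH i); first exact: measurable_xsection.
move=> z; apply: negligibleS (A0 (tcons (x, z))) => h.
by rewrite /= shiftc_tconsS /xsection/= inE.
Qed.

End tuple_null_sets.

Section mixed_pderiv_rec.
Context (R : realType).

Definition psection n (f : pfun R (n.+1.-tuple R)) (x : R) : pfun R (n.-tuple R) :=
  PFun [set z | pdom f (tcons (x, z))] (fun z => f (tcons (x, z))).

Lemma psection_pderiv n (j : 'I_n) (f : pfun R (n.+1.-tuple R)) x :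
  psection (pderiv (lift ord0 j) f) x = pderiv j (psection f x).
Proof.
pose u (h : R) := PFun [set y | pdom f y /\ pdom f (shiftc (lift ord0 j) h y)]
  (fun y => h^-1 * (f (shiftc (lift ord0 j) h y) - f y)).
rewrite -[LHS]/(plim _ (fun h => psection (u h) x)).
congr plim; apply/funext => h; rewrite /u /psection /=.
by congr PFun; apply/funext => z /=; rewrite shiftc_tconsS.
Qed.

Lemma psection_foldr n (f : pfun R (n.+1.-tuple R)) (s : seq 'I_n) x :
  psection (foldr (@pderiv R n.+1) f (map (lift ord0) s)) x =
  foldr (@pderiv R n) (psection f x) s.
Proof. by elim: s => //= j s IH; rewrite psection_pderiv IH. Qed.

(** The derivative along [ord0] is the outermost one, so all the others treat the first coordinate
    as a parameter. *)
Lemma mixed_pderiv_rec n (f : pfun R (n.+1.-tuple R)) :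
  exists2 g, mixed_pderiv f = pderiv ord0 g &
    forall x, psection g x = mixed_pderiv (psection f x).
Proof.
exists (foldr (@pderiv R n.+1) f (map (lift ord0) (enum 'I_n))).
  by rewrite /mixed_pderiv enum_ordSl.
by move=> x; rewrite psection_foldr.
Qed.

End mixed_pderiv_rec.

(** * Iterated Lebesgue differentiation *)

Section half_line_integral.
Context (R : realType).
Notation mu := (@lebesgue_measure R).

(** Dominated convergence for the integrands cut off at [u_ k]: the cut-offs converge at every [v]
    other than [u], and a single point is null. *)
Lemma Rintegral_itvNy_cvg (f_ : (R -> R)^nat) (f g : R -> R) (u_ : R^nat) (u : R) :
    (forall k, measurable_fun setT (f_ k)) -> measurable_fun setT f ->
    mu.-integrable setT (EFin \o g) ->
    {ae mu, forall v, (forall k, 0 <= f_ k v <= g v) /\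
      f_ ^~ v @ \oo --> f v} ->
    u_ @ \oo --> u ->
  \int[mu]_(v in `]-oo, u_ k]) f_ k v @[k --> \oo] -->
  \int[mu]_(v in `]-oo, u]) f v.
Proof.
move=> mf_ mf ig fg uu.
pose F k := ((f_ k) \_ `]-oo, u_ k]); pose F0 := (f \_ `]-oo, u]).
have ae_u : {ae mu, forall v, v != u}.
  exists [set u]; split => //; first exact: lebesgue_measure_set1.
  by move=> v /= /negP /negPn /eqP ->.
have mFk (a : R) (h : R -> R) : measurable_fun setT h ->
    measurable_fun (setT : set (measurableTypeR R)) (EFin \o (h \_ `]-oo, a])).
  move=> mh; apply/measurable_EFinP; apply/(measurable_restrictT _ _).1 => //.
  exact: measurable_funTS.
have ptw : {ae mu, forall v, setT v -> (EFin \o F k) v @[k --> \oo] --> (EFin \o F0) v}.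
  apply: aeS2 ae_u fg => v vu [_ fv] _; rewrite /=.
  apply: cvg_EFin; first by apply: nearW.
  rewrite /F /F0 patchE; case: ifPn => [|]; rewrite (inE, notin_setE)/= in_itv/=.
    rewrite le_eqVlt (negbTE vu)/= => vltu.
    apply: cvg_trans fv; apply: near_eq_cvg; near=> k; rewrite /=.
    rewrite patchE mem_set//= in_itv/= ltW//.
    by near: k; move: uu => /cvgrPdist_lt /(_ (u - v)); rewrite subr_gt0 => /(_ vltu);
       apply: filterS => k; rewrite ltr_distlC => /andP[+ _]; rewrite opprB addrC subrK.
  move/negP; rewrite -ltNge => ultv.
  apply: cvg_near_cst; near=> k; rewrite /=.
  rewrite patchE memNset//= in_itv/=; apply/negP; rewrite -ltNge.
  near: k; move: uu => /cvgrPdist_lt /(_ (v - u)); rewrite subr_gt0 => /(_ ultv).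
  by apply: filterS => k; rewrite ltr_distlC => /andP[_]; rewrite addrC subrK.
have dom : {ae mu, forall v k, setT v -> (`|(EFin \o F k) v| <= (EFin \o g) v)%E}.
  apply: aeS fg => v [fgv _] k _ /=; rewrite lee_fin /F patchE.
  case: ifPn => _; first by have /andP[? ?] := fgv k; rewrite ger0_norm.
  by rewrite normr0; have /andP[fv0 fvg] := fgv 0%N; exact: le_trans fv0 fvg.
have [iF0 _] := dominated_convergence (@measurableT _ _) (fun k => mFk (u_ k) _ (mf_ k))
  (mFk u _ mf) ptw ig dom.
rewrite Rintegral_mkcond -/F0 => cvgF.
under eq_fun do rewrite Rintegral_mkcond.
apply: fine_cvg; rewrite fineK//; exact: integrable_fin_num.
Unshelve. all: by end_near. Qed.

(** For continuous [F] the quotient is continuous in [h] away from 0, so bounds at rational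
    increments extend to all increments. This expresses differentiability by countably many
    conditions. *)
Lemma cvg_diffquot_rat (F : R -> R) (x l : R) : continuous F ->
    (forall r : nat, exists m : nat, forall q : rat,
       0 < `|ratr q : R| < m.+1%:R^-1 ->
       `|(ratr q)^-1 * (F (x + ratr q) - F x) - l| <= r.+1%:R^-1) ->
  h^-1 * (F (x + h) - F x) @[h --> 0^'] --> l.
Proof.
move=> cF hF; apply/cvgrPdist_le => e e0.
have [r re] : exists r : nat, r.+1%:R^-1 <= e.
  by have [r _ /(_ r (leqnn _))/ltW] := near_infty_natSinv_lt (PosNum e0); exists r.
have [m hm] := hF r; pose Q h := h^-1 * (F (x + h) - F x).
near=> h.
have h0 : h != 0 by near: h; exact: nbhs_dnbhs_neq.
have hm1 : `|h| < m.+1%:R^-1 by near: h; apply: dnbhs0_lt.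
have Qc : Q y @[y --> h] --> Q h.
  apply: cvgM; first exact: cvgV.
  apply: cvgB; last exact: cvg_cst.
  apply: continuous_comp; last exact: cF.
  by apply: cvgD; [exact: cvg_cst|exact: cvg_id].
apply: le_trans re; rewrite leNgt; apply/negP => lQ.
(* A violation of the bound is an open condition, so it would also occur at a rational close to
   [h]. *)
have U : \forall y \near h, [/\ r.+1%:R^-1 < `|l - Q y|, y != 0 & `|y| < m.+1%:R^-1].
  near=> y; split.
  - near: y; apply: cvgr_gt lQ => //; apply: cvg_norm.
    by apply: cvgB => //; exact: cvg_cst.
  - rewrite -normr_gt0; near: y; move: h0; rewrite -normr_gt0.
    by apply: cvgr_gt; exact: norm_continuous.
  - near: y; apply: cvgr_lt hm1; exact: norm_continuous.
have [q [lq q0 qm]] : exists q : rat, [/\ r.+1%:R^-1 < `|l - Q (ratr q)|,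
    (ratr q : R) != 0 & `|ratr q : R| < m.+1%:R^-1].
  have /nbhs_ballP[d /= d0 hd] := U.
  have [q qh] := @rat_in_itvoo R (h - d) (h + d) ltac:(by rewrite ltrD2l gtrN).
  exists q; apply: (hd (ratr q)); rewrite /ball/= ltr_distlC.
  by move: qh; rewrite in_itv/=.
by move: lq; rewrite ltNge distrC hm// normr_gt0 q0.
Unshelve. all: by end_near. Qed.

End half_line_integral.

Section head_integral.
Context (R : realType).
Notation mu := (@lebesgue_measure R).

Definition head_integral n (g : n.+1.-tuple R -> R) (u : R) (z : n.-tuple R) : R :=
  \int[mu]_(v in `]-oo, u]) g (tcons (v, z)).

Lemma measurable_head_integrand n (g : n.+1.-tuple R -> R) :
  measurable_fun setT g ->
  measurable_fun setT (fun p : (measurableTypeR R * n.-tuple R) * measurableTypeR R =>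
    (((fun v => g (tcons (v, p.1.2))) \_ `]-oo, p.1.1]) p.2)%:E).
Proof.
move=> mg; apply/measurable_EFinP.
rewrite (_ : (fun _ => _) = fun p : (measurableTypeR R * n.-tuple R) * measurableTypeR R =>
   if p.2 <= p.1.1 then g (tcons (p.2, p.1.2)) else 0); last first.
  apply/funext => p; rewrite patchE.
  by congr (if _ then _ else _); apply/idP/idP; rewrite inE/= in_itv.
apply: measurable_fun_ifT => //=.
- apply: (@measurable_fun_ler _ _ _ _ snd (fst \o fst)).
    exact: (@measurable_snd _ _ _ (measurableTypeR R)).
  exact: (@measurableT_comp _ _ _ _ _ (measurableTypeR R) fst).
- apply: (@measurableT_comp _ _ _ _ _ _ g) => //.
  apply: (@measurableT_comp _ _ _ _ (measurableTypeR R * n.-tuple R)%type _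
    (@tcons R n)); first exact: measurable_tcons.
  apply/measurable_fun_pairP; split.
    exact: (@measurable_snd _ _ _ (measurableTypeR R)).
  exact: (measurableT_comp measurable_snd measurable_fst).
Qed.

Lemma measurable_head_integral n (g : n.+1.-tuple R -> R) :
  measurable_fun setT g -> (forall x, 0 <= g x) ->
  measurable_fun setT
    (fun p : measurableTypeR R * n.-tuple R => head_integral g p.1 p.2).
Proof.
move=> mg g0.
have := @measurable_fun_fubini_tonelli_F _ _ _ _ R mu _ (measurable_head_integrand mg).
rewrite /fubini_F/= => H; rewrite /head_integral /Rintegral.
apply: measurableT_comp; first exact: fine_measurable.
apply: eq_measurable_fun (H _) => [p _|p]; last first.
  by rewrite lee_fin patchE; case: ifPn.
rewrite integral_mkcond; apply: eq_integral => v _.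
by rewrite restrict_EFin.
Qed.

Lemma ae_integrable_head n (g : n.+1.-tuple R -> R) :
  (@lebesgue_tuple R n.+1).-integrable setT (EFin \o g) ->
  {ae @lebesgue_tuple R n, forall z,
     mu.-integrable setT (fun v => (g (tcons (v, z)))%:E)}.
Proof.
move=> /integrableP[mg ig].
apply: (ae_integrable2 (f := fun p => (g (tcons p))%:E)).
apply/integrableP; split.
  apply: (@measurableT_comp _ _ _ _ _ _ (EFin \o g)) => //.
  exact: measurable_tcons.
have := @ge0_integral_lebesgue_tupleS R n (fun x => `|(EFin \o g) x|%E).
by move=> <-//; exact: measurableT_comp.
Qed.

Lemma cvg_diffquot_derive1 (F : R -> R) (x : R) : derivable F x 1 ->
  h^-1 * (F (x + h) - F x) @[h --> 0^'] --> derive1 F x.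
Proof.
move=> dF; rewrite derive1E; apply: cvg_trans dF.
apply: near_eq_cvg; near=> h.
by rewrite /= [h *: 1]mulr1 [x + h]addrC.
Unshelve. all: by end_near. Qed.

Lemma head_integral_continuous n (g : n.+1.-tuple R -> R) (z : n.-tuple R) :
  measurable_fun setT g -> (forall x, 0 <= g x) ->
  mu.-integrable setT (fun v => (g (tcons (v, z)))%:E) ->
  continuous (head_integral g ^~ z).
Proof.
move=> mg g0 ig u; apply/continuous_withinNx/cvgr_dnbhsP => u_ [_ uu].
rewrite /head_integral.
have mgz : measurable_fun setT (fun v => g (tcons (v, z))).
  by move/integrableP : ig => [/measurable_EFinP].
apply: (@Rintegral_itvNy_cvg R (fun _ v => g (tcons (v, z))) _
   (fun v => g (tcons (v, z)))) => //.
by apply: aeW => v; split => [_|]; [rewrite g0 lexx|exact: cvg_cst].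
Qed.

(** The fundamental theorem of calculus handles almost every line in the first direction. Gluing the
    lines into one null set requires a measurable set of good points, hence the rational increments
    in [A]; continuity of the head integral then restores the full limit. *)
Lemma head_integral_derive_ae n (g : n.+1.-tuple R -> R) :
  measurable_fun setT g -> (forall x, 0 <= g x) ->
  (@lebesgue_tuple R n.+1).-integrable setT (EFin \o g) ->
  {ae @lebesgue_tuple R n.+1, forall x, let p := tuncons x in
     h^-1 * (head_integral g (p.1 + h) p.2 - head_integral g p.1 p.2)
       @[h --> 0^'] --> g x}.
Proof.
move=> mg g0 ig.
pose Q h (p : measurableTypeR R * n.-tuple R) :=
  h^-1 * (head_integral g (p.1 + h) p.2 - head_integral g p.1 p.2).
pose A : set (measurableTypeR R * n.-tuple R) := [set p | forall r : nat,
  exists m : nat, forall q : rat, 0 < `|ratr q : R| < m.+1%:R^-1 ->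
    `|Q (ratr q) p - g (tcons p)| <= r.+1%:R^-1].
(* The default 0 is harmless: the condition on increments demands [0 < |qs k|]. *)
pose qs k : R := ratr (odflt 0 (unpickle k : option rat)).
have AE : A = \bigcap_r \bigcup_m \bigcap_k [set p |
    0 < `|qs k| < m.+1%:R^-1 -> `|Q (qs k) p - g (tcons p)| <= r.+1%:R^-1].
  apply/seteqP; split => p /= Ap r.
    by move=> _; have [m Am] := Ap r; exists m => // k _; exact: Am.
  have [m _ Am] := Ap r Logic.I; exists m => q.
  by have := Am (pickle q) Logic.I; rewrite /= /qs pickleK.
have mQ h : measurable_fun setT (Q h).
  apply: measurable_funM => //; apply: measurable_funB;
    last exact: (measurable_head_integral mg g0).
  apply: (@measurableT_comp _ _ _ _ _ _
    (fun p : measurableTypeR R * n.-tuple R => head_integral g p.1 p.2)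
    _ (fun p : measurableTypeR R * n.-tuple R => (p.1 + h, p.2))).
    exact: measurable_head_integral.
  apply/measurable_fun_pairP; split; last exact: measurable_snd.
  by apply: (@measurable_funD _ _ _ _ fst (cst h)) => //; exact: measurable_fst.
have mA : measurable A.
  rewrite AE; apply: bigcapT_measurable => r; apply: bigcupT_measurable => m.
  apply: bigcapT_measurable => k.
  case: (boolP (0 < `|qs k| < m.+1%:R^-1)) => c; last first.
    by rewrite (_ : [set _ | _] = setT)//; apply/seteqP; split.
  rewrite (_ : [set _ | _] = (fun p : measurableTypeR R * n.-tuple R =>
      `|Q (qs k) p - g (tcons p)|) @^-1` `]-oo, r.+1%:R^-1]).
    rewrite -[X in measurable X]setTI.
    have mf : measurable_fun setT (fun p : measurableTypeR R * n.-tuple R =>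
        `|Q (qs k) p - g (tcons p)|).
      apply: measurableT_comp => //; apply: measurable_funB => //.
      exact: (measurableT_comp mg (@measurable_tcons R n)).
    by apply: mf => //; exact: measurable_itv.
  by apply/seteqP; split => p /=; rewrite in_itv/= => h; [apply: h|].
have ae_int := ae_integrable_head ig.
have : {ae @lebesgue_tuple R n.+1, forall x, A (tuncons x)}.
  apply: ae_tuple_of_section => //; apply: aeS ae_int => z iz.
  have iy y : mu.-integrable `]-oo, y] (EFin \o (fun v => g (tcons (v, z)))).
    by apply: integrableS iz.
  have loc := integrable_locally measurableT iz; rewrite patch_setT in loc.
  have := FTC1Ny iy loc.
  apply: aeS => x [dF Fx] r.
  have := cvg_diffquot_derive1 dF; rewrite Fx.
  move=> /cvgrPdist_le /(_ r.+1%:R^-1); rewrite invr_gt0 ltr0Sn => /(_ isT).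
  move=> /nbhs_ballP[d /= d0 hd].
  have [m _ /(_ m (leqnn _)) md] := near_infty_natSinv_lt (PosNum d0).
  exists m => q /andP[q0 qm]; rewrite distrC; apply: hd => /=.
    by rewrite /ball/= sub0r normrN (lt_trans qm).
  by rewrite -normr_gt0.
have := ae_tuple_tail ae_int.
apply: aeS2 => x iz Ax /=.
have := @cvg_diffquot_rat _ (head_integral g ^~ (tuncons x).2) (tuncons x).1 (g x).
apply; first exact: head_integral_continuous.
move=> r; have [m Am] := Ax r; exists m => q /Am.
by rewrite tunconsK.
Qed.

End head_integral.

Section dominated_half_lines.
Context (R : realType).
Notation mu := (@lebesgue_measure R).

Lemma le_Rintegral_ae_subset (A B : set (measurableTypeR R)) (f1 f2 : R -> R) :
    measurable A -> measurable B -> A `<=` B ->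
    measurable_fun setT f1 -> mu.-integrable setT (EFin \o f2) ->
    (forall v, 0 <= f2 v) ->
    {ae mu, forall v, 0 <= f1 v <= f2 v} ->
  \int[mu]_(v in A) f1 v <= \int[mu]_(v in B) f2 v.
Proof.
move=> mA mB AB mf1 if2 f20 f12.
have mf2 : measurable_fun setT f2 by move/integrableP : if2 => [/measurable_EFinP].
have f12' : {ae mu, forall v, (`|(f1 \_ A) v| <= (f2 \_ B) v)}.
  apply: aeS f12 => v /andP[v0 vle]; rewrite !patchE.
  case: ifPn => [/set_mem vA|_]; first by rewrite mem_set ?ger0_norm//; exact: AB.
  by rewrite normr0; case: ifPn.
have m1 : measurable_fun setT (f1 \_ A).
  by apply/(measurable_restrictT _ _).1 => //; exact: measurable_funTS.
have m2 : measurable_fun setT (f2 \_ B).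
  by apply/(measurable_restrictT _ _).1 => //; exact: measurable_funTS.
have i2 : mu.-integrable setT (EFin \o (f2 \_ B)).
  rewrite -restrict_EFin; apply/integrable_restrict => //.
  by rewrite setTI; exact: integrableS if2.
have f2B0 v : 0 <= (f2 \_ B) v by rewrite patchE; case: ifPn.
rewrite Rintegral_mkcond [leRHS]Rintegral_mkcond.
apply: le_trans (ler_norm _) _.
have i1 : mu.-integrable setT (EFin \o (f1 \_ A)).
  apply/integrableP; split; first exact/measurable_EFinP.
  apply: (@le_lt_trans _ _ (\int[mu]_x (EFin \o (f2 \_ B)) x)%E); last exact: integrable_lty.
  apply: ae_ge0_le_integral => //.
  - by apply/measurable_EFinP; exact: measurableT_comp.
  - by move=> v _; rewrite lee_fin.
  - exact/measurable_EFinP.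
  - by apply: aeS f12' => v + _ /=; rewrite lee_fin.
apply: le_trans (le_normr_Rintegral _ _) _ => //.
apply: fine_le.
- apply: integrable_fin_num => //=.
  by have := integrable_abse i1.
- exact: integrable_fin_num.
- apply: ae_ge0_le_integral => //.
  - by apply/measurable_EFinP; exact: measurableT_comp.
  - by move=> v _; rewrite lee_fin.
  - exact/measurable_EFinP.
  - by apply: aeS f12' => v + _ /=; rewrite lee_fin.
Qed.

Lemma le_Rintegral_itvNyB (f1 f2 : R -> R) (x y : R) : x <= y ->
    mu.-integrable setT (EFin \o f1) -> mu.-integrable setT (EFin \o f2) ->
    {ae mu, forall v, f1 v <= f2 v} ->
  \int[mu]_(v in `]-oo, y]) f1 v - \int[mu]_(v in `]-oo, x]) f1 v <=
  \int[mu]_(v in `]-oo, y]) f2 v - \int[mu]_(v in `]-oo, x]) f2 v.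
Proof.
move=> xy if1 if2 f12.
have iA (A : set (measurableTypeR R)) (f : R -> R) : measurable A ->
    mu.-integrable setT (EFin \o f) -> mu.-integrable A (EFin \o f).
  by move=> mA; exact: integrableS.
suff : \int[mu]_(v in `]-oo, x]) (f2 v - f1 v) <=
       \int[mu]_(v in `]-oo, y]) (f2 v - f1 v).
  rewrite !RintegralB//; try exact: iA.
  lra.
(* The difference is nonnegative only almost everywhere; truncating at 0 makes it so everywhere, as
   the comparison over nested half-lines asks. *)
pose f v := Num.max (f2 v - f1 v) 0.
have fE (A : set (measurableTypeR R)) :
    \int[mu]_(v in A) (f2 v - f1 v) = \int[mu]_(v in A) f v.
  congr fine; apply: ae_eq_integral_nomeas; apply: aeS f12 => v le12 _.
  by rewrite /f; congr EFin; apply/esym/max_idPl; rewrite subr_ge0.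
have if21 : mu.-integrable setT (EFin \o f).
  have i0 : mu.-integrable setT (EFin \o (f2 \- f1)).
    by rewrite (_ : _ \o _ = (EFin \o f2) \- (EFin \o f1))%E//; exact: integrableB.
  apply: le_integrable i0 => //.
    apply/measurable_EFinP; apply: measurable_maxr => //.
    by apply: measurable_funB; [case/integrableP : if2|case/integrableP : if1] =>
      /measurable_EFinP.
  move=> v _; rewrite /= lee_fin /f.
  case: (lerP 0 (f2 v - f1 v)) => h; first by [].
  by rewrite normr0.
rewrite !fE; apply: le_Rintegral_ae_subset => //.
- by move=> v /=; rewrite !in_itv/= => /le_trans; apply.
- by case/integrableP : if21 => /measurable_EFinP.
- by move=> v; rewrite /f le_max lexx orbT.
- by apply: aeW => v; rewrite lexx andbT /f le_max lexx orbT.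
Qed.

(** A punctured neighbourhood of 0 contains an interval of positive length, so no null set can
    contain it. *)
Lemma negligible_properfilter (B : set R) : mu.-negligible B ->
  ProperFilter (within (~` B) (0 : R)^').
Proof.
move=> [N [mN N0 BN]]; apply: Build_ProperFilter_ex => A wA.
apply: contrapT => /forallNP nA.
have : \forall h \near (0 : R)^', B h.
  have {}wA : \forall h \near (0 : R)^', ~ B h -> A h by exact: wA.
  near=> h; apply: contrapT => nB; apply: (nA h).
  by apply: (near wA h).
move=> /nbhs_ballP[e /= e0 he].
have : (mu `]0%R, e[%classic <= mu N)%E.
  apply: le_measure; rewrite ?inE//; move=> h /=; rewrite in_itv/= => /andP[h0 hle].
  apply: BN; apply: he; last by rewrite gt_eqF.
  by rewrite /ball/= sub0r normrN gtr0_norm.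
by rewrite N0 lebesgue_measure_itv/= lte_fin e0 oppr0 adde0 leNgt lte_fin e0.
Unshelve. all: by end_near. Qed.

End dominated_half_lines.

(** * Families of densities squeezed by a countable subfamily *)

Section sandwiched_families.
Context (R : realType).
Notation mu := (@lebesgue_measure R).

(** The members indexed through [c] form the countable subfamily; [a p] and [b p] select
    approximations of [rho p] from below and from above. The quantifier over [p] stands inside the
    [ae], so one null set serves all parameters. The integrable [g] bounds the upper approximations,
    hence every member. *)
Definition sandwiched n (P : Type) (I : countType) (rho : P -> n.-tuple R -> R)
    (c : I -> P) (a b : P -> nat -> I) (g : n.-tuple R -> R) : Prop :=
  [/\ (forall p, measurable_fun setT (rho p)), (forall p x, 0 <= rho p x),
      (@lebesgue_tuple R n).-integrable setT (EFin \o g), (forall x, 0 <= g x) &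
      {ae @lebesgue_tuple R n, forall x, forall p,
        (forall k, [/\ rho (c (a p k)) x <= rho p x,
           rho p x <= rho (c (b p k)) x & rho (c (b p k)) x <= g x]) /\
        (rho (c (a p k)) x @[k --> \oo] --> rho p x /\
         rho (c (b p k)) x @[k --> \oo] --> rho p x)}].

Lemma sandwiched_integrable n P I rho c a b g :
  @sandwiched n P I rho c a b g ->
  forall p, (@lebesgue_tuple R n).-integrable setT (EFin \o rho p).
Proof.
move=> [mrho rho0 ig g0 ab] p; apply/integrableP; split; first exact/measurable_EFinP.
apply: (@le_lt_trans _ _ (\int[@lebesgue_tuple R n]_x (EFin \o g) x)%E);
  last exact: integrable_lty.
apply: ae_ge0_le_integral => //.
- by apply: measurableT_comp => //; apply/measurable_EFinP.
- by move=> x _; rewrite lee_fin.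
- by case/integrableP : ig.
- apply: aeS ab => x /(_ p)[/(_ 0%N)[_ le1 le2] _] _ /=.
  by rewrite lee_fin ger0_norm// (le_trans le1).
Qed.

Lemma integrable_section_dominated n (r g : n.+1.-tuple R -> R) (z : n.-tuple R) :
  measurable_fun setT r -> (forall x, 0 <= r x) -> (forall x, 0 <= g x) ->
  mu.-integrable setT (fun v => (g (tcons (v, z)))%:E) ->
  {ae mu, forall v, r (tcons (v, z)) <= g (tcons (v, z))} ->
  mu.-integrable setT (EFin \o (fun v => r (tcons (v, z)))).
Proof.
move=> mr r0 g0 ig rg.
have mrz : measurable_fun setT (fun v : measurableTypeR R => r (tcons (v, z))).
  apply: (@measurableT_comp _ _ _ _ _ _ r) => //.
  by apply: (measurableT_comp (@measurable_tcons R n)); exact: pair2_measurable.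
apply/integrableP; split; first exact/measurable_EFinP.
apply: (@le_lt_trans _ _ (\int[mu]_v (g (tcons (v, z)))%:E)%E);
  last exact: integrable_lty.
apply: ae_ge0_le_integral => //.
- by apply: measurableT_comp => //; apply/measurable_EFinP.
- by move=> v _; rewrite lee_fin.
- by case/integrableP : ig.
- by apply: aeS rg => v rv _ /=; rewrite lee_fin ger0_norm.
Qed.

(** The difference quotient is monotone in the density, so the quotient of [rho q] lies between
    those of two countable members whose densities at [x] are within [e / 2] of [rho q x]; countably
    many null sets suffice. *)
Lemma head_integral_family_derive_ae n P I rho c a b g :
  @sandwiched n.+1 P I rho c a b g ->
  {ae @lebesgue_tuple R n.+1, forall x, forall q, let p := tuncons x in
     h^-1 * (head_integral (rho q) (p.1 + h) p.2 - head_integral (rho q) p.1 p.2)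
       @[h --> 0^'] --> rho q x}.
Proof.
move=> S; have irho := sandwiched_integrable S; case: S => mrho rho0 ig g0 ab.
have D : {ae @lebesgue_tuple R n.+1, forall x, forall i, let p := tuncons x in
     h^-1 * (head_integral (rho (c i)) (p.1 + h) p.2 - head_integral (rho (c i)) p.1 p.2)
       @[h --> 0^'] --> rho (c i) x}.
  by apply: ae_forall_countType => i; exact: head_integral_derive_ae.
have iz : {ae @lebesgue_tuple R n.+1, forall x,
    mu.-integrable setT (fun v => (g (tcons (v, (tuncons x).2)))%:E)}.
  by apply: (ae_tuple_tail (ae_integrable_head ig)).
have abz := ae_tuple_tail (ae_tuple_section ab).
have := aeS2 (fun x h1 h2 => conj h1 h2) (aeS2 (fun x h1 h2 => conj h1 h2) D ab)
  (aeS2 (fun x h1 h2 => conj h1 h2) iz abz).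
apply: aeS => x [[{}D {}ab] [{}iz {}abz]] q /=.
set y := (tuncons x).1; set z := (tuncons x).2.
have ir p : mu.-integrable setT (EFin \o (fun v => rho p (tcons (v, z)))).
  apply: integrable_section_dominated iz _ => //.
  by apply: aeS abz => v /(_ p)[/(_ 0%N)[_ le1 le2] _]; exact: le_trans le2.
pose Q p h := h^-1 * (head_integral (rho p) (y + h) z - head_integral (rho p) y z).
(* For negative [h] both the factor [h^-1] and the increment change sign, so the order is the same
   for either sign of [h]. *)
have leQ p p' h : h != 0 ->
    {ae mu, forall v, rho p (tcons (v, z)) <= rho p' (tcons (v, z))} ->
    Q p h <= Q p' h.
  move=> h0 pp'; have [hgt0|hlt0|h00] := ltrgt0P h; last by rewrite h00 eqxx in h0.
    rewrite /Q ler_pM2l ?invr_gt0//; apply: le_Rintegral_itvNyB => //.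
    by rewrite lerDl ltW.
  rewrite /Q ler_nM2l ?invr_lt0// -lerN2 !opprB; apply: le_Rintegral_itvNyB => //.
  by rewrite gerDl ltW.
apply/cvgrPdist_le => e e0.
have e2 : 0 < e / 2 by rewrite divr_gt0.
have [_ [ca cb]] := ab q.
have [k [Ha Hb]] : exists k, `|rho q x - rho (c (a q k)) x| <= e / 2 /\
    `|rho q x - rho (c (b q k)) x| <= e / 2.
  move/cvgrPdist_le : ca => /(_ _ e2); move/cvgrPdist_le : cb => /(_ _ e2) hb ha.
  have [N _ hN] := filterI ha hb.
  by exists N; exact: (hN N (leqnn N)).
have Da := D (a q k); have Db := D (b q k).
move/cvgrPdist_le : Da => /(_ _ e2) Da; move/cvgrPdist_le : Db => /(_ _ e2) Db.
near=> h.
have h0 : h != 0 by near: h; exact: nbhs_dnbhs_neq.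
have hA : Q (c (a q k)) h <= Q q h.
  by apply: leQ => //; apply: aeS abz => v /(_ q)[/(_ k)[]].
have hB : Q q h <= Q (c (b q k)) h.
  by apply: leQ => //; apply: aeS abz => v /(_ q)[/(_ k)[]].
have da : `|rho (c (a q k)) x - Q (c (a q k)) h| <= e / 2 by near: h.
have db : `|rho (c (b q k)) x - Q (c (b q k)) h| <= e / 2 by near: h.
rewrite -/(Q q h); move: Ha Hb da db; rewrite !ler_norml => *.
lra.
Unshelve. all: by end_near. Qed.

Lemma rat_approx (u : R) (k : nat) : exists q : rat * rat,
  u - k.+1%:R^-1 < ratr q.1 <= u /\ u <= ratr q.2 < u + k.+1%:R^-1.
Proof.
have k0 : 0 < k.+1%:R^-1 :> R by rewrite invr_gt0.
have [q1 h1] := @rat_in_itvoo R (u - k.+1%:R^-1) u ltac:(by rewrite gtrBl).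
have [q2 h2] := @rat_in_itvoo R u (u + k.+1%:R^-1) ltac:(by rewrite ltrDl).
exists (q1, q2); move: h1 h2; rewrite !in_itv/=.
by move=> /andP[-> /ltW ->] /andP[/ltW -> ->].
Qed.

Definition rat_below (u : R) (k : nat) : rat := (projT1 (cid (rat_approx u k))).1.
Definition rat_above (u : R) (k : nat) : rat := (projT1 (cid (rat_approx u k))).2.

Lemma rat_belowP u k : u - k.+1%:R^-1 < ratr (rat_below u k) <= u.
Proof. by rewrite /rat_below; case: cid => q []. Qed.

Lemma rat_aboveP u k : u <= ratr (rat_above u k) < u + k.+1%:R^-1.
Proof. by rewrite /rat_above; case: cid => q []. Qed.

Lemma cvg_rat_below u : ratr (rat_below u k) @[k --> \oo] --> u.
Proof.
apply/cvgrPdist_lt => e e0; near=> k.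
have /andP[h1 h2] := rat_belowP u k.
have ke : k.+1%:R^-1 < e by near: k; exact: (near_infty_natSinv_lt (PosNum e0)).
by rewrite ger0_norm ?subr_ge0// (lt_trans _ ke)// ltrBlDr addrC -ltrBlDr.
Unshelve. all: by end_near. Qed.

Lemma cvg_rat_above u : ratr (rat_above u k) @[k --> \oo] --> u.
Proof.
apply/cvgrPdist_lt => e e0; near=> k.
have /andP[h1 h2] := rat_aboveP u k.
have ke : k.+1%:R^-1 < e by near: k; exact: (near_infty_natSinv_lt (PosNum e0)).
by rewrite distrC ger0_norm ?subr_ge0// (lt_trans _ ke)// ltrBlDr addrC.
Unshelve. all: by end_near. Qed.

(** Serves as the common bound one dimension lower: it dominates the head integrals of functions
    below [g], for every upper limit. *)
Definition full_head_integral n (g : n.+1.-tuple R -> R) (z : n.-tuple R) : R :=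
  \int[mu]_v g (tcons (v, z)).

Lemma full_head_integral_integrable n (g : n.+1.-tuple R -> R) :
  (@lebesgue_tuple R n.+1).-integrable setT (EFin \o g) -> (forall x, 0 <= g x) ->
  (@lebesgue_tuple R n).-integrable setT (EFin \o full_head_integral g).
Proof.
move=> ig g0.
have mg : measurable_fun setT g by case/integrableP : ig => /measurable_EFinP.
have mgt : measurable_fun setT (fun p => (g (@tcons R n p))%:E).
  by apply/measurable_EFinP; exact: (measurableT_comp mg (@measurable_tcons R n)).
have gt0 (p : measurableTypeR R * n.-tuple R) : (0 <= (g (tcons p))%:E)%E.
  by rewrite lee_fin.
have mG := @measurable_fun_fubini_tonelli_G _ _ _ _ R mu _ mgt gt0.
have Gfin : (\int[@lebesgue_tuple R n]_z
    fubini_G mu (fun p : measurableTypeR R * n.-tuple R => (g (tcons p))%:E) z < +oo)%E.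
  rewrite -(fubini_tonelli2 (m1 := mu) _ mgt)//.
  rewrite -(@ge0_integral_lebesgue_tupleS R n (EFin \o g)) ?integrable_lty//.
  exact/measurable_EFinP.
have iG : (@lebesgue_tuple R n).-integrable setT
    (fubini_G mu (fun p : measurableTypeR R * n.-tuple R => (g (tcons p))%:E)).
  apply/integrableP; split => //.
  under eq_integral => z _ do rewrite gee0_abs ?integral_ge0//.
  exact: Gfin.
apply: le_integrable iG => //.
  apply/measurable_EFinP.
  by apply: (measurableT_comp (fine_measurable _)).
move=> z _ /=; rewrite /full_head_integral /Rintegral /fubini_G.
(* Where the inner integral is infinite, [fine] returns 0 and the bound still holds. *)
by case: (\int[mu]_v _)%E => [r||] //=; rewrite ?normr0 ?lee_fin ?leey.
Qed.

(** The upper limit [u] joins the parameter. Head integrals increase with the density and with [u],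
    so pairing the old lower approximation with a rational below [u], and the upper one with a
    rational above, squeezes again; [Rintegral_itvNy_cvg] gives both limits. *)
Lemma sandwiched_head n P I rho c a b g : @sandwiched n.+1 P I rho c a b g ->
  @sandwiched n (P * R) (I * rat)%type
    (fun pu => head_integral (rho pu.1) pu.2)
    (fun iq => (c iq.1, ratr iq.2))
    (fun pu k => (a pu.1 k, rat_below pu.2 k))
    (fun pu k => (b pu.1 k, rat_above pu.2 k))
    (full_head_integral g).
Proof.
move=> [mrho rho0 ig g0 ab]; split.
- move=> [p u] /=.
  have mh := measurable_head_integral (mrho p) (rho0 p).
  exact: (measurableT_comp mh (pair1_measurable (u : measurableTypeR R))).
- by move=> [p u] z; apply: Rintegral_ge0 => v _; exact: rho0.
- exact: full_head_integral_integrable.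
- by move=> z; apply: Rintegral_ge0 => v _; exact: g0.
have iz := ae_integrable_head ig; have abz := ae_tuple_section ab.
apply: aeS2 iz abz => z {}iz {}abz [p u] /=.
have msec (f : n.+1.-tuple R -> R) : measurable_fun setT f ->
    measurable_fun setT (fun v => f (tcons (v, z))).
  move=> mf; apply: (@measurableT_comp _ _ _ _ _ _ f) => //.
  by apply: (measurableT_comp (@measurable_tcons R n)); exact: pair2_measurable.
have ir q : mu.-integrable setT (EFin \o (fun v => rho q (tcons (v, z)))).
  apply: integrable_section_dominated iz _ => //.
  by apply: aeS abz => v /(_ q)[/(_ 0%N)[_ le1 le2] _]; exact: le_trans le2.
split=> [k|]; [split|split].
- have /andP[_ le_u] := rat_belowP u k.
  apply: le_Rintegral_ae_subset => //; try exact: msec.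
  + by move=> v /=; rewrite !in_itv/= => /le_trans; apply.
  + by apply: aeS abz => v /(_ p)[/(_ k)[? _ _] _]; rewrite rho0.
- have /andP[le_u _] := rat_aboveP u k.
  apply: le_Rintegral_ae_subset => //; try exact: msec.
  + by move=> v /=; rewrite !in_itv/= => /le_trans; apply.
  + by apply: aeS abz => v /(_ p)[/(_ k)[_ ? _] _]; rewrite rho0.
- apply: le_Rintegral_ae_subset => //; try exact: msec.
  by apply: aeS abz => v /(_ p)[/(_ k)[_ _ ?] _]; rewrite rho0.
- apply: (@Rintegral_itvNy_cvg R (fun k v => rho (c (a p k)) (tcons (v, z))) _
    (fun v => g (tcons (v, z)))) => //.
  + by move=> k; exact: msec.
  + exact: msec.
  + apply: aeS abz => v /(_ p)[sq [ca cb]]; split => // k.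
    by have [h1 h2 h3] := sq k; rewrite rho0 (le_trans h1)// (le_trans h2).
  + exact: cvg_rat_below.
- apply: (@Rintegral_itvNy_cvg R (fun k v => rho (c (b p k)) (tcons (v, z))) _
    (fun v => g (tcons (v, z)))) => //.
  + by move=> k; exact: msec.
  + exact: msec.
  + apply: aeS abz => v /(_ p)[sq [ca cb]]; split => // k.
    by have [h1 h2 h3] := sq k; rewrite rho0.
  + exact: cvg_rat_above.
Qed.

End sandwiched_families.

Section lower_sets.
Context (R : realType).
Notation mu := (@lebesgue_measure R).

Definition lower_set n (x : n.-tuple R) : set (n.-tuple R) :=
  [set y | forall i, tnth y i <= tnth x i].

Lemma measurable_lower_set n (x : n.-tuple R) : measurable (lower_set x).
Proof.
rewrite (_ : lower_set x =
    \bigcap_(i in [set: 'I_n]) ((@tnth n R ^~ i) @^-1` `]-oo, tnth x i])).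
  apply: fin_bigcap_measurable => // i _; rewrite -[X in measurable X]setTI.
  by apply: measurable_tnth => //; exact: measurable_itv.
apply/seteqP; split => y yx i /=; first by move=> _; rewrite in_itv/=; exact: yx.
by have := yx i Logic.I; rewrite /= in_itv.
Qed.

Lemma integral_lower_set_tcons n (rho : n.+1.-tuple R -> R) u (z : n.-tuple R) :
  measurable_fun setT rho -> (forall x, 0 <= rho x) ->
  (@lebesgue_tuple R n.+1).-integrable setT (EFin \o rho) ->
  (\int[@lebesgue_tuple R n.+1]_(y in lower_set (tcons (u, z))) (rho y)%:E =
   \int[@lebesgue_tuple R n]_(y in lower_set z) (head_integral rho u y)%:E)%E.
Proof.
move=> mrho rho0 irho.
rewrite integral_mkcond ge0_integral_lebesgue_tuple_head; last 2 first.
- apply/(measurable_restrictT _ _).1; first exact: measurable_lower_set.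
  by apply: measurable_funTS; apply/measurable_EFinP.
- by move=> y; rewrite patchE; case: ifPn => // _; rewrite lee_fin.
rewrite [RHS]integral_mkcond; apply: ae_eq_integral_nomeas.
apply: aeS (ae_integrable_head irho) => y iy _; rewrite patchE.
have consE v : (tcons (v, y) \in lower_set (tcons (u, z))) =
    (v <= u) && (y \in lower_set z).
  apply/idP/andP; rewrite !inE.
    move=> h; split; first by have := h ord0; rewrite !tnth_tcons0.
    by move=> i; have := h (lift ord0 i); rewrite !tnth_tconsS.
  move=> [vu yz] i; case: (unliftP ord0 i) => [j|] ->.
    by rewrite !tnth_tconsS; exact: yz.
  by rewrite !tnth_tcons0.
case: ifPn => yz; last first.
  by rewrite integral0_eq// => v _; rewrite patchE consE (negbTE yz) andbF.
rewrite /head_integral /Rintegral fineK; last first.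
  by apply: integrable_fin_num => //; exact: integrableS iy.
rewrite [RHS]integral_mkcond; apply: eq_integral => v _; rewrite !patchE consE yz andbT.
by congr (if _ then _ else _); apply/idP/idP; rewrite inE/= in_itv.
Qed.

End lower_sets.

Section mixed_pderiv_density.
Context (R : realType).
Notation mu := (@lebesgue_measure R).

(* The parameter [p] collects the upper limits of the integrations that are
   still to be differentiated: after the derivative in the last coordinates, the
   remaining ones are taken along whole coordinate lines, so the derivative must
   be known for a.e. value of the last coordinates but for ALL values of the
   others. *)
Lemma mixed_pderiv_sandwiched n : forall (P : Type) (I : countType)
    (rho : P -> n.-tuple R -> R) (c : I -> P) (a b : P -> nat -> I)
    (g : n.-tuple R -> R) (f : P -> pfun R (n.-tuple R)) (E : P -> set (n.-tuple R)),
  sandwiched rho c a b g ->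
  (forall p x, pdom (f p) x ->
     (f p x)%:E = (\int[@lebesgue_tuple R n]_(y in lower_set x) (rho p y)%:E)%E) ->
  (forall p, E p `<=` pdom (f p)) ->
  (forall p x j, E p x -> mu.-negligible [set h | ~ E p (shiftc j h x)]) ->
  {ae @lebesgue_tuple R n, forall x, forall p,
     (pdom (mixed_pderiv (f p)) x -> mixed_pderiv (f p) x = rho p x) /\
     (E p x -> pdom (mixed_pderiv (f p)) x)}.
Proof.
elim: n => [|n IH] P I rho c a b g f E S fE Edom Enull.
  apply: aeW => x p; rewrite /mixed_pderiv (size0nil (size_enum_ord 0))/=.
  split => [xf|]; last exact: Edom.
  apply: EFin_inj; rewrite fE//.
  have -> : lower_set x = setT by apply/seteqP; split => // y _ [].
  case: S => mrho _ _ _ _.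
  rewrite integral_dirac//; last exact/measurable_EFinP.
  by rewrite diracT mul1e; congr (rho p _)%:E; rewrite (tuple0 x).
have irho := sandwiched_integrable S.
(* Freezing the first coordinate turns it into the upper limit that [sandwiched_head] adds to the
   parameter. *)
pose f' (pu : P * R) := psection (f pu.1) pu.2.
pose E' (pu : P * R) := [set z | E pu.1 (tcons (pu.2, z))].
have := IH _ _ _ _ _ _ _ f' E' (sandwiched_head S).
have [mrho rho0 _ _ _] := S.
move=> /(_ _)/wrap[|].
  move=> [p u] z /= pz; rewrite fE//.
  by rewrite integral_lower_set_tcons.
move=> /(_ _)/wrap[|]; first by move=> [p u] z; exact: Edom.
move=> /(_ _)/wrap[|].
  move=> [p u] z j Ez /=; apply: negligibleS (Enull _ _ (lift ord0 j) Ez) => h.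
  by rewrite /= shiftc_tconsS.
move=> /ae_tuple_tail; have := head_integral_family_derive_ae S.
apply: aeS2; elim/tcons_ind => x z; rewrite tconsK /= => D H p.
have [G GE Gsec] := mixed_pderiv_rec (f p).
have GP u : (pdom G (tcons (u, z)) -> G (tcons (u, z)) = head_integral (rho p) u z) /\
    (E p (tcons (u, z)) -> pdom G (tcons (u, z))).
  by have := H (p, u); rewrite /f' /= -Gsec.
pose Dom := [set h : R | pdom G (tcons (x, z)) /\ pdom G (shiftc ord0 h (tcons (x, z)))].
(* Wherever [G] is defined it equals the head integral, so on [Dom] its quotients coincide with
   those that converge by [D]. *)
have cvgD : h^-1 * (G (shiftc ord0 h (tcons (x, z))) - G (tcons (x, z)))
    @[h --> within Dom (0 : R)^'] --> rho p (tcons (x, z)).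
  apply: cvg_trans (cvg_within_filter Dom (D p)).
  apply: near_eq_cvg; rewrite near_withinE; apply: nearW => h [d1 d2].
  rewrite shiftc_tcons0 in d2 *.
  by rewrite (GP x).1// (GP (x + h)).1.
rewrite GE /pderiv /plim /=; split.
  by move=> [pF _]; apply/cvg_lim.
move=> Exz; split; last by apply/cvg_ex; exists (rho p (tcons (x, z))).
(* Almost every point of the line through an [E]-point lies in [E], hence in the domain of [G]; thus
   [Dom] accumulates at 0. *)
have := negligible_properfilter (Enull p _ ord0 Exz).
move=> pF; apply: Build_ProperFilter_ex => A wA.
have [h Ah] : exists h, A h; last by exists h.
apply: (@filter_ex _ _ pF).
have {}wA : \forall h \near (0 : R)^', Dom h -> A h by exact: wA.
rewrite /within/=; near=> h => /contrapT Eh; apply: (near wA h) => //.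
split; first exact: (GP x).2.
by rewrite shiftc_tcons0 in Eh *; exact: (GP (x + h)).2.
Unshelve. all: by end_near. Qed.

End mixed_pderiv_density.

Section mixed_pderiv_of_density.
Context (R : realType).
Notation mu := (@lebesgue_measure R).

Definition pshift (V : Type) (f : pfun R V) (k : R) : pfun R V :=
  PFun (pdom f) (fun x => f x + k).

Lemma pderiv_pshift n (j : 'I_n) (f : pfun R (n.-tuple R)) k :
  pderiv j (pshift f k) = pderiv j f.
Proof.
by congr plim; apply/funext => h; congr PFun; apply/funext => x /=;
  rewrite opprD addrACA subrr addr0.
Qed.

(** The innermost derivative removes the constant; for [n = 0] no derivative is taken and the
    constant would survive. *)
Lemma mixed_pderiv_pshift n (f : pfun R (n.-tuple R)) k : (0 < n)%N ->
  mixed_pderiv (pshift f k) = mixed_pderiv f.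
Proof.
case: n f => // n f _.
by rewrite /mixed_pderiv enum_ordSr -!cats1 !foldr_cat/= pderiv_pshift.
Qed.

Lemma mixed_pderiv_of_density n (rho : n.-tuple R -> R) (f : pfun R (n.-tuple R))
    (k : R) (E : set (n.-tuple R)) : (0 < n)%N ->
  measurable_fun setT rho -> (forall x, 0 <= rho x) ->
  (@lebesgue_tuple R n).-integrable setT (EFin \o rho) ->
  (forall x, pdom f x ->
    f x = fine (\int[@lebesgue_tuple R n]_(y in lower_set x) (rho y)%:E)%E + k) ->
  E `<=` pdom f ->
  (forall x j, E x -> mu.-negligible [set h | ~ E (shiftc j h x)]) ->
  {ae @lebesgue_tuple R n, forall x,
     (pdom (mixed_pderiv f) x -> mixed_pderiv f x = rho x) /\
     (E x -> pdom (mixed_pderiv f) x)}.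
Proof.
move=> n0 mrho rho0 irho fE Edom Enull.
(* The induction starts from a one-member family, which squeezes itself. *)
have S : sandwiched (fun _ : unit => rho) (fun _ : unit => tt) (fun _ _ => tt)
    (fun _ _ => tt) rho.
  by split => //; apply: aeW => x _; split => [k'|]; split => //; exact: cvg_cst.
have := mixed_pderiv_sandwiched (f := fun=> pshift f (- k)) (E := fun=> E) S.
rewrite mixed_pderiv_pshift// => /(_ _)/wrap[|].
  move=> _ x /= xf; rewrite fE// addrK fineK//; apply: integrable_fin_num => //.
    exact: measurable_lower_set.
  by apply: integrableS irho => //; exact: measurable_lower_set.
move=> /(_ _)/wrap[//|] /(_ _)/wrap[|]; first by move=> _; exact: Enull.
by apply: aeS => x; exact.
Qed.

End mixed_pderiv_of_density.

(** * The price of a call on the maximum *)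

Section bounded_convergence.
Context d (T : measurableType d) (R : realType) (Q : probability T R).

(** Eventual equality is the form needed: difference quotients of the piecewise linear payoff and
    the indicators met below become stationary at almost every [w]. *)
Lemma cvg_Rintegral_bounded (f_ : (T -> R)^nat) (f : T -> R) (C : R) :
  (forall k, measurable_fun setT (f_ k)) -> measurable_fun setT f ->
  {ae Q, forall w, \forall k \near \oo, f_ k w = f w} ->
  (forall k w, `|f_ k w| <= C) ->
  \int[Q]_w f_ k w @[k --> \oo] --> \int[Q]_w f w.
Proof.
move=> mf_ mf ff fC.
have ptw : {ae Q, forall w, setT w -> (EFin \o f_ k) w @[k --> \oo] --> (EFin \o f) w}.
  apply: aeS ff => w fw _; apply: cvg_EFin; first exact: nearW.
  by apply: cvg_near_cst; apply: filterS fw => k /= ->.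
have dom : {ae Q, forall w k, setT w -> (`|(EFin \o f_ k) w| <= (EFin \o cst C) w)%E}.
  by apply: aeW => w k _ /=; rewrite lee_fin.
have [iF0 _] := @dominated_convergence _ T R Q setT measurableT
  (fun k => EFin \o f_ k) (EFin \o f) (EFin \o cst C)
  (fun k => (measurable_EFinP _ _).2 (mf_ k)) ((measurable_EFinP _ _).2 mf)
  ptw (finite_measure_integrable_cst Q C measurableT) dom.
move=> cvgF; apply: fine_cvg; rewrite fineK//; exact: integrable_fin_num.
Qed.

Lemma Rintegral_indic (B : set T) : measurable B -> \int[Q]_w \1_B w = fine (Q B).
Proof. by move=> mB; rewrite /Rintegral integral_indic// setIT. Qed.

Lemma cvg_probability (B_ : (set T)^nat) (B : set T) :
  (forall k, measurable (B_ k)) -> measurable B ->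
  {ae Q, forall w, \forall k \near \oo, B_ k w <-> B w} ->
  fine (Q (B_ k)) @[k --> \oo] --> fine (Q B).
Proof.
move=> mB_ mB BB; rewrite -Rintegral_indic//.
under eq_fun do rewrite -Rintegral_indic//.
apply: (@cvg_Rintegral_bounded (fun k => \1_(B_ k)) (\1_B) 1).
- by move=> k; exact: measurable_indic.
- exact: measurable_indic.
- apply: aeS BB => w; apply: filterS => k Bk; rewrite !indicE; congr (nat_of_bool _)%:R.
  by apply/idP/idP; rewrite !inE => /Bk.
- by move=> k w; rewrite indicE; case: (_ \in _); rewrite ?normr1 ?normr0.
Qed.

End bounded_convergence.

Section max_call.
Context d (T : measurableType d) (R : realType) (Q : probability T R).
Context (n : nat) (M : 'I_n -> T -> R).
Hypothesis mM : forall i, measurable_fun setT (M i).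
Hypothesis iM : forall i, Q.-integrable setT (EFin \o M i).
Implicit Types (x : n.-tuple R) (j : 'I_n) (w : T).

(** The initial value 0 of the maximum supplies the positive part. With [predC1 j] for [P] it is the
    best that the competitors of stock [j] achieve. *)
Definition best_call (P : pred 'I_n) x w : R :=
  \big[Num.max/0]_(i < n | P i) (M i w - tnth x i).

Lemma measurable_best_call P x : measurable_fun setT (best_call P x).
Proof.
rewrite /best_call; elim: (index_enum _) => [|i s IH].
  by under eq_fun do rewrite big_nil; exact: measurable_cst.
under eq_fun do rewrite big_cons; case: (P i) => //.
by apply: measurable_maxr => //; exact: measurable_funB.
Qed.

Lemma best_call_ge0 P x w : 0 <= best_call P x w.
Proof. exact: bigmax_ge_id. Qed.

Lemma integrable_best_call P x : Q.-integrable setT (EFin \o best_call P x).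
Proof.
have iS (s : seq 'I_n) : Q.-integrable setT
    (EFin \o (fun w => \sum_(i <- s) (`|M i w| + `|tnth x i|))).
  elim: s => [|i s IH].
    by rewrite /comp; under eq_fun do rewrite big_nil; exact: integrable0.
  rewrite /comp; under eq_fun do rewrite big_cons EFinD.
  apply: integrableD => //; under eq_fun do rewrite EFinD.
  apply: integrableD => //;
    last exact: (finite_measure_integrable_cst Q `|tnth x i| measurableT).
  by have := integrable_abse (iM i).
apply: le_integrable (iS (index_enum _)) => //.
  by apply/measurable_EFinP; exact: measurable_best_call.
move=> w _; rewrite /= lee_fin ger0_norm ?best_call_ge0//.
rewrite ger0_norm; last by apply: sumr_ge0 => i _; rewrite addr_ge0.
apply: bigmax_le; first by apply: sumr_ge0 => i _; rewrite addr_ge0.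
move=> i _; apply: (@le_trans _ _ (`|M i w| + `|tnth x i|)).
  by apply: le_trans (ler_norm _) _; exact: ler_normB.
rewrite (bigD1 i)//= lerDl; apply: sumr_ge0 => k _; exact: addr_ge0.
Qed.

Definition call_price x : R := \int[Q]_w best_call predT x w.

Lemma best_callD1 j x w :
  best_call predT x w =
  Num.max (M j w - tnth x j) (best_call (predC1 j) x w).
Proof. by rewrite /best_call (bigmaxD1 j). Qed.

Lemma best_call_shiftc j h x w :
  best_call predT (shiftc j h x) w =
  Num.max (M j w - tnth x j - h) (best_call (predC1 j) x w).
Proof.
rewrite (best_callD1 j) tnth_mktuple eqxx opprD addrA; congr Num.max.
apply: eq_bigr => i /= ij; rewrite tnth_mktuple.
by case: ifP => // /eqP iej; rewrite iej eqxx in ij.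
Qed.

Let quot j x h w : R :=
  h^-1 * (best_call predT (shiftc j h x) w - best_call predT x w).

(** Bounds the difference quotients of the payoff by 1, uniformly in [w], so that limits pass under
    the expectation. *)
Lemma max_lipschitz (m a h : R) :
  `|Num.max (m - h) a - Num.max m a| <= `|h|.
Proof.
rewrite ler_norml; case: (ler0P h) => h0; case: (leP (m - h) a) => h1;
  case: (leP m a) => h2; apply/andP; split; lra.
Qed.

Lemma call_price_diffquot_cvg j x (B : set T) (u : R^nat) : measurable B ->
  (forall k, u k != 0) ->
  (forall w, \forall k \near \oo, quot j x (u k) w = - \1_B w) ->
  (u k)^-1 * (call_price (shiftc j (u k) x) - call_price x) @[k --> \oo] -->
  - fine (Q B).
Proof.
move=> mB u0 uB.
have mq h : measurable_fun setT (quot j x h).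
  by apply: measurable_funM => //; apply: measurable_funB; exact: measurable_best_call.
have -> : - fine (Q B) = \int[Q]_w (- \1_B w).
  rewrite -Rintegral_indic// -mulN1r -RintegralZl//; last exact: integrable_indic.
  by apply: eq_Rintegral => w _; rewrite mulN1r.
have E k : (u k)^-1 * (call_price (shiftc j (u k) x) - call_price x) =
    \int[Q]_w quot j x (u k) w.
  rewrite /call_price -RintegralB//; try exact: integrable_best_call.
  rewrite -RintegralZl//.
  rewrite (_ : _ \o _ = (EFin \o best_call predT (shiftc j (u k) x)) \-
    (EFin \o best_call predT x))%E//.
  by apply: integrableB => //; exact: integrable_best_call.
under eq_fun do rewrite E.
apply: (@cvg_Rintegral_bounded _ _ _ Q (fun k => quot j x (u k)) _ 1) => //.
- by apply: measurableT_comp => //; exact: measurable_indic.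
- exact: aeW.
- move=> k w; rewrite /quot best_call_shiftc (best_callD1 j) normrM normfV.
  by rewrite ler_pdivrMl ?normr_gt0// mulr1 max_lipschitz.
Qed.

Definition wins j x : set T := [set w | best_call (predC1 j) x w < M j w - tnth x j].
Definition wins_or_ties j x : set T :=
  [set w | best_call (predC1 j) x w <= M j w - tnth x j].

Lemma measurable_wins j x : measurable (wins j x).
Proof.
rewrite (_ : wins j x =
    ~` [set w | M j w - tnth x j <= best_call (predC1 j) x w]).
  apply: measurableC; rewrite -[X in measurable X]setTI.
  apply: measurable_fun_le => //; last exact: measurable_best_call.
  exact: measurable_funB.
by apply/seteqP; split => w; rewrite /wins/= ltNge => /negP.
Qed.

Lemma measurable_wins_or_ties j x : measurable (wins_or_ties j x).
Proof.
rewrite -[X in measurable X]setTI; apply: measurable_fun_le => //.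
  exact: measurable_best_call.
exact: measurable_funB.
Qed.

(** Raising strike [j] by less than the winning margin lowers the payoff at slope 1; without a
    strict win, the competitors already determine the payoff and nothing changes. *)
Lemma call_price_right_derivative j x :
  h^-1 * (call_price (shiftc j h x) - call_price x) @[h --> 0^'+] -->
  - fine (Q (wins j x)).
Proof.
apply/cvg_at_rightP => u [u0 ucvg].
apply: call_price_diffquot_cvg; first exact: measurable_wins.
  by move=> k; rewrite gt_eqF.
move=> w; rewrite /quot; under eq_near do rewrite best_call_shiftc (best_callD1 j) indicE.
set m := M j w - tnth x j; set a := best_call _ x w.
case: (ltP a m) => am.
  have ma : 0 < m - a by rewrite subr_gt0.
  have um : \forall k \near \oo, u k < m - a.
    by apply: (cvgr_lt 0).
  apply: filterS um => k um. rewrite mem_set//= max_l; last lra.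
  by rewrite addrAC subrr sub0r mulrN mulVf// gt_eqF.
apply: nearW => k; have uk := u0 k; rewrite memNset//=;
  last by rewrite /wins/= -/m -/a ltNge am.
rewrite max_r; last lra.
by rewrite subrr mulr0 oppr0.
Qed.

(** Lowering strike [j] makes a tied stock win at once, so ties count on this side. *)
Lemma call_price_left_derivative j x :
  h^-1 * (call_price (shiftc j h x) - call_price x) @[h --> 0^'-] -->
  - fine (Q (wins_or_ties j x)).
Proof.
apply/cvg_at_leftP => u [u0 ucvg].
apply: call_price_diffquot_cvg; first exact: measurable_wins_or_ties.
  by move=> k; rewrite lt_eqF.
move=> w; rewrite /quot; under eq_near do rewrite best_call_shiftc (best_callD1 j) indicE.
set m := M j w - tnth x j; set a := best_call _ x w.
case: (leP a m) => am.
  apply: nearW => k; have uk := u0 k; rewrite mem_set//= max_l; last lra.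
  by rewrite addrAC subrr sub0r mulrN mulVf// lt_eqF.
have ma : m - a < 0 by rewrite subr_lt0.
have um : \forall k \near \oo, m - a < u k by apply: (cvgr_gt 0).
apply: filterS um => k um; rewrite memNset//=;
  last by rewrite /wins_or_ties/= -/m -/a leNgt am.
rewrite max_r; last lra.
by rewrite subrr mulr0 oppr0.
Qed.

(** A two-sided derivative agrees with both one-sided ones. Thus mere existence identifies the two
    probabilities, with no separate assumption on ties. *)
Lemma pderiv_call_price j x : pdom (pderiv j (ptotal call_price)) x ->
  pderiv j (ptotal call_price) x = - fine (Q (wins j x)) /\
  pderiv j (ptotal call_price) x = - fine (Q (wins_or_ties j x)).
Proof.
rewrite /pderiv /plim/= within_total => -[_ c].
set l := lim _.
have {}c : h^-1 * (call_price (shiftc j h x) - call_price x) @[h --> 0^'] --> l.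
  by exact: c.
have cr := cvg_dnbhs_at_right c; have cl := cvg_dnbhs_at_left c.
split.
  by rewrite -(cvg_lim _ cr)//; apply/cvg_lim => //; exact: call_price_right_derivative.
by rewrite -(cvg_lim _ cl)//; apply/cvg_lim => //; exact: call_price_left_derivative.
Qed.

Lemma pdom_pderiv_call_price j x :
  Q [set w | best_call (predC1 j) x w = M j w - tnth x j] = 0%E ->
  pdom (pderiv j (ptotal call_price)) x.
Proof.
move=> Q0.
have E : Q (wins_or_ties j x) = Q (wins j x).
  set ties := (X in Q X) in Q0.
  have -> : wins_or_ties j x = wins j x `|` ties.
    apply/seteqP; split => w; rewrite /wins /wins_or_ties /ties/= le_eqVlt.
      by case/orP => [/eqP|]; [right|left].
    by case => [->|->]; rewrite ?orbT ?eqxx.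
  rewrite measureU0//; first exact: measurable_wins.
  rewrite (_ : ties = wins_or_ties j x `\` wins j x).
    by apply: measurableD; [exact: measurable_wins_or_ties|exact: measurable_wins].
  apply/seteqP; split => w; rewrite /wins /wins_or_ties /ties/=.
    by move=> ->; rewrite lexx ltxx.
  by move=> [le1 /negP]; rewrite -leNgt => le2; apply/eqP; rewrite eq_le le1.
rewrite /pderiv /plim/= within_total; split; first exact: Proper_dnbhs_numFieldType.
apply/cvg_ex; exists (- fine (Q (wins j x))).
apply: (@cvg_at_right_left_dnbhs _ R^o); first exact: call_price_right_derivative.
by rewrite -E; exact: call_price_left_derivative.
Qed.

Definition no_call x : set T := [set w | forall i, M i w <= tnth x i].

Lemma measurable_no_call x : measurable (no_call x).
Proof.
rewrite (_ : no_call x = \bigcap_(i in [set: 'I_n]) [set w | M i w <= tnth x i]).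
  apply: fin_bigcap_measurable => // i _; rewrite -[X in measurable X]setTI.
  exact: measurable_fun_le.
by apply/seteqP; split => w wx i //; [move=> _|]; apply: wx.
Qed.

(** Two stocks cannot both win strictly, and a strict winner has a positive payoff. *)
Lemma sum_wins_le x w : (\sum_(j < n) \1_(wins j x) w <= \1_(~` no_call x) w :> R).
Proof.
have [[j wj]|nj] := pselect (exists j, wins j x w); last first.
  rewrite big1 ?indicE ?ler0n// => j _; rewrite indicE memNset// => wj.
  by apply: nj; exists j.
rewrite (bigD1 j)//= big1 => [|i ij]; last first.
  rewrite indicE memNset// /wins/= => wi.
  have h1 : M i w - tnth x i <= best_call (predC1 j) x w.
    by apply: (le_bigmax_cond 0 (fun i => M i w - tnth x i)).
  have h2 : M j w - tnth x j <= best_call (predC1 i) x w.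
    by apply: (le_bigmax_cond 0 (fun i => M i w - tnth x i)); rewrite /= eq_sym.
  have := lt_le_trans wi (le_trans h1 (le_trans (ltW wj) h2)).
  by rewrite ltxx.
rewrite addr0 !indicE (@mem_set _ (~` _)) ?lern1 ?leq_b1// => /(_ j).
have := le_lt_trans (best_call_ge0 (predC1 j) x w) wj.
by rewrite subr_gt0 ltNge => /negbTE ->.
Qed.

(** If some stock exceeds its strike, a maximizer of [M i w - tnth x i] beats 0 and all competitors
    weakly. *)
Lemma sum_wins_or_ties_ge x w :
  (\1_(~` no_call x) w <= \sum_(j < n) \1_(wins_or_ties j x) w :> R).
Proof.
have [/existsNP[i /negP]|] := pselect (~ no_call x w); last first.
  move=> nc; rewrite [leLHS]indicE memNset//.
  by apply: sumr_ge0 => j _; rewrite indicE ler0n.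
rewrite -ltNge -subr_gt0 => xi.
pose m i := M i w - tnth x i.
have [j mj] : exists j, forall k, m k <= m j.
  by exists [arg max_(j > i) m j]%O; case: arg_maxP => //= j _ h k; exact: h.
rewrite (bigD1 j)//= [X in _ <= X + _]indicE mem_set; last first.
  rewrite /wins_or_ties/=; apply: bigmax_le => [|k _]; last exact: mj.
  by apply: le_trans (ltW xi) _; exact: mj.
apply: (@le_trans _ _ 1); first by rewrite indicE lern1 leq_b1.
by rewrite lerDl; apply: sumr_ge0 => k _; rewrite indicE ler0n.
Qed.

(** The event that some stock exceeds its strike is squeezed between the number of strict winners
    and the number of weak winners. Each derivative can be read off from either kind of winner, so
    both inequalities bound the same sum. *)
Lemma sum_pderiv_call_price x :
  (forall j, pdom (pderiv j (ptotal call_price)) x) ->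
  \sum_(j < n) pderiv j (ptotal call_price) x = fine (Q (no_call x)) - 1.
Proof.
move=> xdom.
have mC : measurable (~` no_call x) by apply: measurableC; exact: measurable_no_call.
have -> : fine (Q (no_call x)) - 1 = - fine (Q (~` no_call x)).
  rewrite probability_setC; last exact: measurable_no_call.
  rewrite fineB//; last by rewrite fin_num_measure//; exact: measurable_no_call.
  by rewrite opprB.
have int_sum (A : 'I_n -> set T) : (forall j, measurable (A j)) ->
    \sum_(j < n) fine (Q (A j)) = fine (\int[Q]_w (\sum_(j < n) \1_(A j) w)%:E)%E.
  move=> mA; under [in RHS]eq_integral do rewrite -sumEFin.
  rewrite ge0_integral_sum//.
    under [in RHS]eq_bigr do rewrite integral_indic// setIT.
    rewrite (eq_bigr (fun j => (fine (Q (A j)))%:E)) ?sumEFin// => j _.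
    by rewrite fineK// fin_num_measure.
  by move=> j; apply/measurable_EFinP; exact: measurable_indic.
have fin_int (f : T -> R) : Q.-integrable setT (EFin \o f) ->
    (\int[Q]_w (f w)%:E)%E \is a fin_num.
  by move=> ?; exact: integrable_fin_num.
have isum (A : 'I_n -> set T) : (forall j, measurable (A j)) ->
    Q.-integrable setT (EFin \o (fun w => \sum_(j < n) \1_(A j) w)).
  move=> mA; rewrite /comp; under eq_fun do rewrite -sumEFin.
  by apply: integrable_sum => // j _; exact: integrable_indic.
have iC := integrable_indic Q mC.
apply/eqP; rewrite eq_le; apply/andP; split.
  rewrite (eq_bigr (fun j => - fine (Q (wins_or_ties j x)))) => [|j _]; last first.
    by have [] := pderiv_call_price (xdom j).
  rewrite sumrN lerN2 int_sum => [|j]; last exact: measurable_wins_or_ties.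
  have <- : (\int[Q]_w (\1_(~` no_call x) w)%:E)%E = Q (~` no_call x).
    by rewrite integral_indic// setIT.
  apply: fine_le; [exact: fin_int|apply: fin_int; apply: isum => j;
    exact: measurable_wins_or_ties|].
  apply: le_integral => //.
    by apply: isum => j; exact: measurable_wins_or_ties.
  by move=> w _; rewrite lee_fin sum_wins_or_ties_ge.
rewrite [leRHS](eq_bigr (fun j => - fine (Q (wins j x)))) => [|j _]; last first.
  by have [] := pderiv_call_price (xdom j).
rewrite sumrN lerN2 int_sum => [|j]; last exact: measurable_wins.
have <- : (\int[Q]_w (\1_(~` no_call x) w)%:E)%E = Q (~` no_call x).
  by rewrite integral_indic// setIT.
apply: fine_le; [apply: fin_int; apply: isum => j;
  exact: measurable_wins|exact: fin_int|].
apply: le_integral => //; first by apply: isum => j; exact: measurable_wins.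
by move=> w _; rewrite lee_fin sum_wins_le.
Qed.

End max_call.

(** * Strikes at which ties have probability zero *)

Section generic_strikes.
Context d (T : measurableType d) (R : realType) (Q : probability T R).
Notation mu := (@lebesgue_measure R).

Lemma countable_atoms (X : T -> R) : measurable_fun setT X ->
  countable [set r | Q [set w | X w = r] <> 0%E].
Proof.
move=> mX.
pose X' : {RV Q >-> R} := HB.pack X (isMeasurableFun.Build _ _ _ _ X mX).
apply: sub_countable (pmf_gt0_countable X'); apply: subset_card_le => r /= Xr.
rewrite /pmf fine_gt0// lt0e measure_ge0 andbT; apply/andP; split.
  by apply/eqP.
by rewrite -ge0_fin_numE ?measure_ge0// fin_num_measure.
Qed.

Lemma negligible_affine_preimage (C : set R) (s r : R) : (s = 1 \/ s = -1) ->
  countable C -> mu.-negligible [set h | C (r + s * h)].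
Proof.
move=> s1 cC.
(* As [s * s = 1], the map [c => s * (c - r)] inverts [h => r + s * h]. *)
have cI : countable ((fun c => s * (c - r)) @` C).
  by apply: sub_countable cC; exact: card_image_le.
have : mu.-negligible ((fun c => s * (c - r)) @` C).
  apply/negligibleP; last exact: countable_lebesgue_measure0.
  by apply: countable_measurable => // x; exact: measurable_set1.
apply: negligibleS => h /= Ch; exists (r + s * h) => //.
by rewrite addrAC subrr add0r mulrA; case: s1 => ->; rewrite ?mulrNN !mul1r.
Qed.

Context (n : nat) (M : 'I_n -> T -> R).
Hypothesis mM : forall i, measurable_fun setT (M i).

(** The first clause rules out a tie with the value 0, the second a tie between two stocks. Each
    excludes only countably many values of a coordinate or of a difference of coordinates. *)
Definition generic_strike (x : n.-tuple R) : Prop :=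
  (forall j, Q [set w | M j w = tnth x j] = 0%E) /\
  (forall i j, i != j -> Q [set w | M i w - M j w = tnth x i - tnth x j] = 0%E).

Let C1 j := [set r | Q [set w | M j w = r] <> 0%E].
Let C2 i j := [set r | Q [set w | M i w - M j w = r] <> 0%E].

Let countable_C1 j : countable (C1 j). Proof. exact: countable_atoms. Qed.
Let countable_C2 i j : countable (C2 i j).
Proof. by apply: (@countable_atoms (M i \- M j)); exact: measurable_funB. Qed.

Lemma generic_strike_ae : {ae @lebesgue_tuple R n, forall x, generic_strike x}.
Proof.
have mc (C : set R) : countable C -> measurable C.
  by move=> cC; apply: countable_measurable => // x; exact: measurable_set1.
have ae1 : {ae @lebesgue_tuple R n, forall x, forall j, Q [set w | M j w = tnth x j] = 0%E}.
  apply: ae_forall_countType => j.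
  have mA : measurable [set x : n.-tuple R | C1 j (tnth x j)].
    rewrite -[X in measurable X]setTI; apply: (measurable_tnth j) => //.
    exact: mc.
  exists [set x : n.-tuple R | C1 j (tnth x j)]; split => //.
  apply: (lebesgue_tuple_lines0 (j := j)) => // x.
  apply: negligibleS
    (@negligible_affine_preimage (C1 j) 1 (tnth x j) (or_introl erefl) _) => //.
  by move=> h /=; rewrite tnth_mktuple eqxx mul1r.
have ae2 : {ae @lebesgue_tuple R n, forall x, forall ij : 'I_n * 'I_n, ij.1 != ij.2 ->
    Q [set w | M ij.1 w - M ij.2 w = tnth x ij.1 - tnth x ij.2] = 0%E}.
  apply: ae_forall_countType => -[i j] /=.
  have [->|ij] := eqVneq i j; first exact: aeW.
  pose A := [set x : n.-tuple R | C2 i j (tnth x i - tnth x j)].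
  have mA : measurable A.
    have mf : measurable_fun setT (fun x : n.-tuple R => tnth x i - tnth x j).
      by apply: measurable_funB; exact: measurable_tnth.
    by rewrite -[X in measurable X]setTI; apply: mf => //; exact: mc.
  exists A; split => //; last by move=> x /= nx Qx; apply: nx.
  apply: (lebesgue_tuple_lines0 (j := i)) => // x.
  apply: negligibleS (@negligible_affine_preimage (C2 i j) 1
    (tnth x i - tnth x j) (or_introl erefl) _) => //.
  move=> h /=; rewrite /A/= !tnth_mktuple eqxx eq_sym (negbTE ij) mul1r.
  by rewrite addrAC.
apply: aeS2 ae1 ae2 => x h1 h2; split => // i j ij.
exact: (h2 (i, j)).
Qed.

(** Moving along axis [j] changes [tnth x j] and its differences to other coordinates at slope 1 or
    -1, so each meets its atoms for countably many [h]; the remaining conditions do not change. *)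
Lemma generic_strike_lines x j : generic_strike x ->
  mu.-negligible [set h | ~ generic_strike (shiftc j h x)].
Proof.
move=> [x1 x2].
have N1 : {ae mu, forall h, ~ C1 j (tnth x j + 1 * h)}.
  apply: negligibleS
    (@negligible_affine_preimage (C1 j) 1 (tnth x j) (or_introl erefl) _) => //.
  by move=> h /= /contrapT.
have N2 : {ae mu, forall h, forall i, ~ C2 i j (tnth x i - tnth x j + (-1) * h)}.
  apply: ae_forall_countType => i.
  apply: negligibleS
    (@negligible_affine_preimage (C2 i j) (-1) (tnth x i - tnth x j) (or_intror erefl) _) => //.
  by move=> h /= /contrapT.
have N3 : {ae mu, forall h, forall i, ~ C2 j i (tnth x j - tnth x i + 1 * h)}.
  apply: ae_forall_countType => i.
  apply: negligibleS
    (@negligible_affine_preimage (C2 j i) 1 (tnth x j - tnth x i) (or_introl erefl) _) => //.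
  by move=> h /= /contrapT.
suff : {ae mu, forall h, generic_strike (shiftc j h x)} by [].
apply: aeS2 N1 (aeS2 (fun h a b => conj a b) N2 N3) => h /contrapT n1 [n2 n3].
split=> [i|i k ik].
  rewrite tnth_mktuple; case: eqP => [->|_]; last exact: x1.
  by rewrite -[h]mul1r.
rewrite !tnth_mktuple; case: (eqVneq i j) ik => [->|ij]; case: (eqVneq k j) => [->|kj] //.
- move=> _; have /contrapT := n3 k; rewrite mul1r.
  by rewrite (_ : tnth x j - tnth x k + h = tnth x j + h - tnth x k)// addrAC.
- move=> _; have /contrapT := n2 i; rewrite mulN1r.
  by rewrite (_ : tnth x i - tnth x j - h = tnth x i - (tnth x j + h))// opprD addrA.
- exact: x2.
Qed.

Lemma generic_strike_no_tie x j : generic_strike x ->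
  Q [set w | best_call M (predC1 j) x w = M j w - tnth x j] = 0%E.
Proof.
move=> [x1 x2].
have mtie : measurable [set w | best_call M (predC1 j) x w = M j w - tnth x j].
  rewrite (_ : [set _ | _] = wins_or_ties M j x `\` wins M j x).
    apply: measurableD; [exact: measurable_wins_or_ties|exact: measurable_wins].
  apply/seteqP; split => w; rewrite /wins /wins_or_ties/=.
    by move=> ->; rewrite lexx ltxx.
  by move=> [le1 /negP]; rewrite -leNgt => le2; apply/eqP; rewrite eq_le le1.
apply: measure_negligible => //.
have ae1 : {ae Q, forall w, M j w <> tnth x j}.
  apply/negligibleP; last first.
    by rewrite -(x1 j); congr (Q _); apply/seteqP;
      split => w /=; [move=> /contrapT|move=> ? []].
  rewrite (_ : ~` _ = M j @^-1` [set tnth x j]); last first.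
    by apply/seteqP; split => w /=; [move=> /contrapT|move=> ? []].
  by rewrite -[X in measurable X]setTI; apply: mM => //; exact: measurable_set1.
have ae2 : {ae Q, forall w, forall i, i != j -> M i w - M j w <> tnth x i - tnth x j}.
  apply: ae_forall_countType => i; have [->|ij] := eqVneq i j; first exact: aeW.
  apply: aeS (_ : {ae Q, forall w, M i w - M j w <> tnth x i - tnth x j}) => //.
  apply/negligibleP; last first.
    by rewrite -(x2 i j ij); congr (Q _); apply/seteqP;
      split => w /=; [move=> /contrapT|move=> ? []].
  rewrite (_ : ~` _ = (M i \- M j) @^-1` [set tnth x i - tnth x j]); last first.
    by apply/seteqP; split => w /=; [move=> /contrapT|move=> ? []].
  have mf : measurable_fun setT (M i \- M j) by exact: measurable_funB.
  by rewrite -[X in measurable X]setTI; apply: mf => //; exact: measurable_set1.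
suff : {ae Q, forall w, ~ (best_call M (predC1 j) x w = M j w - tnth x j)}.
  by apply: negligibleS => w /= tie nt; exact: nt.
apply: aeS2 ae1 ae2 => w w1 w2 tie.
(* The tied value is nonnegative as a best call, and [w1] excludes 0. By [w2] each competitor then
   lies strictly below it, which contradicts the tie. *)
have m0 : 0 < M j w - tnth x j.
  rewrite lt_neqAle -tie best_call_ge0 andbT tie eq_sym subr_eq0.
  exact/eqP.
have : best_call M (predC1 j) x w < M j w - tnth x j; last by rewrite tie ltxx.
apply: bigmax_lt => // i ij; rewrite lt_neqAle -{2}tie.
apply/andP; split; last exact: (le_bigmax_cond 0 (fun i => M i w - tnth x i)).
apply/eqP => e; apply: (w2 i) => //; lra.
Qed.

End generic_strikes.

(** * Look-back options *)

Section running_maximum.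
Context d (Omega : measurableType d) (R : realType) (Q : probability Omega R).
Context (n : nat) (S : 'I_n -> R -> {RV Q >-> R}) (T : R).
Hypothesis T_gt0 : 0 < T.
Hypothesis S_gt0 : forall i (t : R) w, t \in `[0, T] -> 0 < S i t w.
Hypothesis S_rcont : forall w i (t : R), t \in `[0, T[ -> S i u w @[u --> t^'+] --> S i t w.
Hypothesis S_max : forall i w, exists2 t : R, t \in `[0, T] &
  forall u : R, u \in `[0, T] -> S i u w <= S i t w.
Hypothesis S_max_fin : forall i, ('E_Q[running_max S T i] < +oo)%E.
Implicit Types (a b t s : R) (i : 'I_n) (w : Omega).

Definition window_max a b i w : R := sup [set S i t w | t in `[a, b]].

Let window_sub a b t : 0 <= a -> b <= T -> t \in `[a, b] -> t \in `[0, T].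
Proof.
move=> a0 bT; rewrite !in_itv/= => /andP[at_ tb].
by rewrite (le_trans a0 at_) (le_trans tb bT).
Qed.

Lemma window_has_ubound a b i w : 0 <= a -> b <= T ->
  has_ubound [set S i t w | t in `[a, b]].
Proof.
move=> a0 bT; have [t tT tmax] := S_max i w.
by exists (S i t w) => _ [u uab <-]; apply: tmax; exact: window_sub uab.
Qed.

Lemma le_window_max a b i w t : 0 <= a -> b <= T -> t \in `[a, b] ->
  S i t w <= window_max a b i w.
Proof.
move=> a0 bT tab; apply: ub_le_sup; first exact: window_has_ubound.
by exists t.
Qed.

Lemma window_max_le a b i w c : a <= b ->
  (forall t, t \in `[a, b] -> S i t w <= c) -> window_max a b i w <= c.
Proof.
move=> ab h; apply: ge_sup; last by move=> _ [t tab <-]; exact: h.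
by exists (S i a w), a => //=; rewrite in_itv/= lexx.
Qed.

Lemma window_max_ge0 a b i w : 0 <= a -> a <= b -> b <= T ->
  0 <= window_max a b i w.
Proof.
move=> a0 ab bT; have aab : a \in `[a, b] by rewrite in_itv/= lexx.
apply: le_trans (le_window_max i w a0 bT aab).
by apply/ltW/S_gt0; exact: window_sub aab.
Qed.

(* By right-continuity the supremum over [a, b] is the supremum over its rational
   points and [b]. *)
Let time a b (k : nat) : R :=
  let q := ratr (odflt 0 (unpickle k : option rat)) in
  if q \in `[a, b] then q else b.

Let time_itv a b k : a <= b -> time a b k \in `[a, b].
Proof. by move=> ab; rewrite /time; case: ifP => // _; rewrite in_itv/= ab lexx. Qed.

Lemma window_max_sups a b i w : 0 <= a -> a <= b -> b <= T ->
  window_max a b i w = sups (fun k => S i (time a b k) w) 0.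
Proof.
move=> a0 ab bT; rewrite /sups/=.
have ub : has_ubound (sdrop (fun k => S i (time a b k) w) 0).
  have [c hc] := window_has_ubound i w a0 bT.
  by exists c => _ [k _ <-]; apply: hc; exists (time a b k) => //; exact: time_itv.
have le_sups t : (exists k, time a b k = t) ->
    S i t w <= sup (sdrop (fun k => S i (time a b k) w) 0).
  by move=> [k <-]; apply: ub_le_sup => //; exists k.
(* A rational beyond [b] falls into the default branch, so [b] is enumerated even when
   irrational. *)
have endb : exists k, time a b k = b.
  have [q] := @rat_in_itvoo R b (b + 1) ltac:(by rewrite ltrDl).
  rewrite in_itv/= => /andP[bq _].
  exists (pickle q); rewrite /time pickleK/= in_itv/=.
  by rewrite (leNgt _ b) bq andbF.
apply/eqP; rewrite eq_le; apply/andP; split.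
  apply: window_max_le => // t; rewrite in_itv/= => /andP[at_].
  rewrite le_eqVlt => /predU1P[->|tb]; first exact: le_sups.
  have tT : t \in `[0, T[ by rewrite in_itv/= (le_trans a0)//= (lt_le_trans tb).
  rewrite leNgt; apply/negP => lt_sup.
  have : \forall u \near t^'+, sup (sdrop (fun k => S i (time a b k) w) 0) < S i u w.
    by apply: (cvgr_gt (S i t w)) => //; exact: S_rcont.
  (* Exceeding the countable supremum at [t] would persist to the right of [t], and a rational time
     there belongs to the enumeration. *)
  rewrite near_withinE => /nbhs_ballP[e /= e0 he].
  have [q] := @rat_in_itvoo R t (Num.min (t + e) b) ltac:(by rewrite lt_min ltrDl e0 tb).
  rewrite in_itv/= lt_min => /and3P[tq qe qb].
  have := he (ratr q); rewrite /ball/= ltr0_norm ?subr_lt0// opprB ltrBlDl.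
  move=> /(_ qe tq); rewrite ltNge => /negP; apply; apply: le_sups.
  exists (pickle q); rewrite /time pickleK/= in_itv/= ifT//.
  by rewrite (le_trans at_ (ltW tq)) (ltW qb).
apply: ge_sup; first by exists (S i (time a b 0) w), 0%N.
by move=> _ [k _ <-]; apply: le_window_max => //; exact: time_itv.
Qed.

Lemma measurable_window_max a b i : 0 <= a -> a <= b -> b <= T ->
  measurable_fun setT (window_max a b i).
Proof.
move=> a0 ab bT.
rewrite (_ : window_max a b i = (fun w => sups (fun k => S i (time a b k) w) 0)).
  apply: (measurable_fun_sups (h := fun k w => S i (time a b k) w)).
    move=> w _; have [c hc] := window_has_ubound i w a0 bT.
    by exists c => _ [k _ <-]; apply: hc; exists (time a b k) => //; exact: time_itv.
  by move=> k; exact: measurable_funPT.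
by apply/funext => w; exact: window_max_sups.
Qed.

Lemma integrable_window_max a b i : 0 <= a -> a <= b -> b <= T ->
  Q.-integrable setT (EFin \o window_max a b i).
Proof.
move=> a0 ab bT.
have iT : Q.-integrable setT (EFin \o running_max S T i).
  apply/integrableP; split.
    by apply/measurable_EFinP; apply: (measurable_window_max i (lexx 0) (ltW T_gt0)).
  have := S_max_fin i; rewrite unlock; congr (_ < _)%E; apply: eq_integral => w _.
  by rewrite /= ger0_norm//; apply: window_max_ge0 => //; exact: ltW.
apply: le_integrable iT => //.
  by apply/measurable_EFinP; exact: measurable_window_max.
move=> w _; rewrite /= lee_fin ger0_norm ?window_max_ge0//.
apply: le_trans (ler_norm _); apply: window_max_le => // t tab.
by apply: (@le_window_max 0 T) => //; exact: window_sub tab.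
Qed.

Lemma f_ML_best_call a b (x : n.-tuple R) w : (0 < n)%N ->
  0 <= a -> a <= b -> b <= T ->
  f_ML S a b x w = best_call (window_max a b) predT x w.
Proof.
move=> n0 a0 ab bT.
have aab : a \in `[a, b] by rewrite in_itv/= lexx.
have ne : [set y | exists i t, t \in `[a, b] /\
    y = Num.max (S i t w - tnth x i) 0] !=set0.
  by eexists; exists (Ordinal n0), a.
have ub : ubound [set y | exists i t, t \in `[a, b] /\
    y = Num.max (S i t w - tnth x i) 0] (best_call (window_max a b) predT x w).
  move=> _ [i [t [tab ->]]]; rewrite ge_max best_call_ge0 andbT.
  apply: le_trans (le_bigmax _ (fun i => window_max a b i w - tnth x i) i).
  by rewrite lerD2r; exact: le_window_max.
apply/eqP; rewrite eq_le; apply/andP; split; first exact: ge_sup.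
have hub : has_ubound [set y | exists i t, t \in `[a, b] /\
    y = Num.max (S i t w - tnth x i) 0] by eexists; exact: ub.
apply: bigmax_le => [|i _].
  apply: (@le_trans _ _ (Num.max (S (Ordinal n0) a w - tnth x (Ordinal n0)) 0)).
    by rewrite le_max lexx orbT.
  by apply: ub_le_sup => //; exists (Ordinal n0), a.
rewrite lerBlDr; apply: window_max_le => // t tab; rewrite -lerBlDr.
apply: (@le_trans _ _ (Num.max (S i t w - tnth x i) 0)).
  by rewrite le_max lexx.
by apply: ub_le_sup => //; exists i, t.
Qed.

Lemma V_ML_call_price a b : (0 < n)%N -> 0 <= a -> a <= b -> b <= T ->
  V_ML S a b = call_price Q (window_max a b).
Proof.
move=> n0 a0 ab bT; apply/funext => x; rewrite /V_ML /call_price /Rintegral unlock.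
by congr fine; apply: eq_integral => w _; rewrite f_ML_best_call.
Qed.

End running_maximum.

Section law_density.
Context d (Omega : measurableType d) (R : realType) (Q : probability Omega R).
Context (n : nat) (S : 'I_n -> R -> {RV Q >-> R}) (t : R) (rho : n.-tuple R -> R).
Hypothesis mrho : measurable_fun setT rho.
Hypothesis rho_ge0 : forall x, 0 <= rho x.
Hypothesis rho_law : forall A : set (n.-tuple R), measurable A ->
  (Q [set w | A (stocks S t w)] =
   \int[@lebesgue_tuple R n]_(x in A `&` @orthant R n) (rho x)%:E)%E.

(** Extension by zero: the lower sets behind the distribution function leave the orthant, where
    [rho] is unconstrained by the law. *)
Definition rho_orthant : n.-tuple R -> R := rho \_ (@orthant R n).

Lemma measurable_orthant : measurable (@orthant R n).
Proof.
rewrite (_ : @orthant R n =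
    \bigcap_(i in [set: 'I_n]) ((@tnth n R ^~ i) @^-1` `]0, +oo[)).
  apply: fin_bigcap_measurable => // i _; rewrite -[X in measurable X]setTI.
  by apply: measurable_tnth => //; exact: measurable_itv.
apply/seteqP; split => y yx i /=; first by move=> _; rewrite in_itv/= andbT; exact: yx.
by have := yx i Logic.I; rewrite /= in_itv/= andbT.
Qed.

Lemma measurable_rho_orthant : measurable_fun setT rho_orthant.
Proof.
apply/(measurable_restrictT _ _).1; first exact: measurable_orthant.
exact: measurable_funTS.
Qed.

Lemma rho_orthant_ge0 x : 0 <= rho_orthant x.
Proof. by rewrite /rho_orthant patchE; case: ifP. Qed.

Lemma law_rho_orthant (A : set (n.-tuple R)) : measurable A ->
  (Q [set w | A (stocks S t w)] =
   \int[@lebesgue_tuple R n]_(x in A) (rho_orthant x)%:E)%E.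
Proof.
move=> mA; rewrite rho_law// integral_mkcondr; apply: eq_integral => x _.
by rewrite restrict_EFin.
Qed.

Lemma integrable_rho_orthant :
  (@lebesgue_tuple R n).-integrable setT (EFin \o rho_orthant).
Proof.
apply/integrableP; split; first by apply/measurable_EFinP; exact: measurable_rho_orthant.
under eq_integral => x _ do rewrite /= ger0_norm ?rho_orthant_ge0//.
rewrite -law_rho_orthant// (_ : [set _ | _] = setT); last by apply/seteqP; split.
by rewrite probability_setT ltry.
Qed.

(** The hyperplane where coordinate [i] equals [c] meets each line in direction [i] once, so it is
    null, and the law has a density. *)
Lemma stock_no_atom i c : Q [set w | S i t w = c] = 0%E.
Proof.
pose A := [set x : n.-tuple R | tnth x i = c].
have mA : measurable A.
  rewrite (_ : A = (@tnth n R ^~ i) @^-1` [set c])// -[X in measurable X]setTI.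
  by apply: (measurable_tnth i) => //; exact: measurable_set1.
have A0 : lebesgue_tuple A = 0%E.
  apply: (lebesgue_tuple_lines0 (j := i)) => // x.
  exists [set c - tnth x i]; split; first exact: measurable_set1.
    exact: lebesgue_measure_set1.
  by move=> h; rewrite /A/= tnth_mktuple eqxx => <-; rewrite addrAC subrr add0r.
have -> : [set w | S i t w = c] = [set w | A (stocks S t w)].
  by apply/seteqP; split => w; rewrite /A/= tnth_mktuple.
rewrite law_rho_orthant// (ae_eq_integral_nomeas (g := cst 0%E)) ?integral0//.
by exists A; split => // x /= /not_implyP[].
Qed.

Lemma joint_cdf_density x : joint_cdf S t x =
  fine (\int[@lebesgue_tuple R n]_(y in lower_set x) (rho_orthant y)%:E)%E.
Proof.
rewrite -law_rho_orthant; last exact: measurable_lower_set.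
congr (fine (Q _)); apply/seteqP; split => w /= h i.
  by have := h i; rewrite tnth_mktuple.
by have := h i; rewrite tnth_mktuple.
Qed.

Lemma measurable_stocks : measurable_fun setT (stocks S t).
Proof.
apply/measurable_fun_tnthP => i.
rewrite (_ : _ \o _ = S i t); first exact: measurable_funPT.
by apply/funext => w /=; rewrite tnth_mktuple.
Qed.

End law_density.

(** * The sum of the strike derivatives as the window shrinks *)

Section look_back_derivative.
Context d (Omega : measurableType d) (R : realType) (Q : probability Omega R).
Context (n : nat) (S : 'I_n -> R -> {RV Q >-> R}) (T : R).
Hypothesis n_gt0 : (0 < n)%N.
Hypothesis T_gt0 : 0 < T.
Hypothesis S_gt0 : forall i (t : R) w, t \in `[0, T] -> 0 < S i t w.
Hypothesis S_rcont : forall w i (t : R), t \in `[0, T[ -> S i u w @[u --> t^'+] --> S i t w.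
Hypothesis S_max : forall i w, exists2 t : R, t \in `[0, T] &
  forall u : R, u \in `[0, T] -> S i u w <= S i t w.
Hypothesis S_max_fin : forall i, ('E_Q[running_max S T i] < +oo)%E.
Notation mu := (@lebesgue_measure R).

Let mW a b i := @measurable_window_max _ _ _ _ _ _ _ S_rcont S_max a b i.
Let iW a b i := @integrable_window_max _ _ _ _ _ _ _ T_gt0 S_gt0 S_rcont S_max S_max_fin a b i.
Let VE a b := @V_ML_call_price _ _ _ _ _ _ _ S_max a b n_gt0.

Lemma generic_pdom_V_ML t s x j : 0 <= t -> 0 < s -> t + s <= T ->
  generic_strike Q (window_max S t (t + s)) x ->
  pdom (pderiv j (ptotal (V_ML S t (t + s)))) x.
Proof.
move=> t0 s0 tsT gx; have tts : t <= t + s by rewrite lerDl ltW.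
rewrite VE//; apply: pdom_pderiv_call_price.
- by move=> i; exact: mW.
- by move=> i; exact: iW.
- by apply: generic_strike_no_tie => // i; exact: mW.
Qed.

Context (t : R).
Hypothesis t_ge0 : 0 <= t.
Hypothesis t_ltT : t < T.
Hypothesis no_atom : forall i c, Q [set w | S i t w = c] = 0%E.

(** If some stock is above its strike at time [t], the event fails for every window; if all are
    strictly below, right-continuity keeps them below on a short window. Equality at time [t] is
    excluded almost surely by [no_atom]. *)
Lemma no_call_cvg x :
  fine (Q (no_call (window_max S t (t + s)) x)) @[s --> 0^'+] --> joint_cdf S t x.
Proof.
apply/cvg_at_rightP => u [u0 ucvg].
(* The cap keeps every window inside [[0, T]], where measurability is known; it is inactive for
   large [k]. *)
pose v k := Num.min (u k) (T - t).
have v0 k : 0 < v k by rewrite lt_min u0 subr_gt0.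
have vT k : t + v k <= T by rewrite -lerBrDl ge_min lexx orbT.
have tv k : t <= t + v k by rewrite lerDl ltW.
have uv : \forall k \near \oo, u k = v k.
  have : \forall k \near \oo, u k < T - t by apply: (cvgr_lt 0) => //; rewrite subr_gt0.
  by apply: filterS => k uk; rewrite /v min_l// ltW.
apply: (@cvg_trans _ (fine (Q (no_call (window_max S t (t + v k)) x)) @[k --> \oo])).
  by apply: near_eq_cvg; apply: filterS uv => k ->.
rewrite /joint_cdf; apply: cvg_probability.
- by move=> k; apply: measurable_no_call => i; exact: mW.
- by apply: measurable_no_call => i; exact: measurable_funPT.
have : {ae Q, forall w, forall i, S i t w <> tnth x i}.
  apply: ae_forall_countType => i.
  have mS : measurable (S i t @^-1` [set tnth x i]).
    by apply: measurable_funPTI; exact: measurable_set1.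
  exists (S i t @^-1` [set tnth x i]); split; [exact: mS|exact: no_atom|].
  by move=> w /= /contrapT.
apply: aeS => w Sx; have [le_x|] := pselect (forall i, S i t w <= tnth x i); last first.
  move=> nle; apply: nearW => k; split => // h; exfalso; apply: nle => i.
  apply: le_trans (h i).
  by apply: (le_window_max S_max) => //; rewrite in_itv/= lexx tv.
have lt_x i : S i t w < tnth x i by rewrite lt_neqAle le_x andbT; apply/eqP.
have tT : t \in `[0, T[ by rewrite in_itv/= t_ge0.
have nr : \forall r \near t^'+, forall i, S i r w < tnth x i.
  apply: filter_forall => i; apply: (cvgr_lt (S i t w)) => //; exact: S_rcont.
move: nr; rewrite near_withinE => /nbhs_ballP[e /= e0 he].
have ue : \forall k \near \oo, u k < e by apply: (cvgr_lt 0).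
apply: filterS2 uv ue => k ukv uke; split => // _ i.
apply: window_max_le; first exact: tv.
move=> r; rewrite in_itv/= le_eqVlt => /andP[/predU1P[<-|tr] rv]; first exact: le_x.
apply/ltW; apply: (he r) => //; rewrite /ball/= ltr0_norm ?subr_lt0// opprB ltrBlDl.
by rewrite (le_lt_trans rv)// ltrD2l -ukv.
Qed.

Let defined_at x := [set s : R | forall j, pdom (pderiv j (ptotal (V_ML S t (t + s)))) x].

Let dV_ML_cvg x : \sum_(j < n) pderiv j (ptotal (V_ML S t (t + s))) x
  @[s --> within (defined_at x) 0^'+] --> joint_cdf S t x - 1.
Proof.
have c : fine (Q (no_call (window_max S t (t + s)) x)) - 1
    @[s --> within (defined_at x) 0^'+] --> joint_cdf S t x - 1.
  apply: cvgB; last exact: cvg_cst.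
  exact: (cvg_within_filter (defined_at x) (@no_call_cvg x)).
apply: cvg_trans c; apply: near_eq_cvg; rewrite near_withinE; near=> s => xs.
have s0 : 0 < s by near: s; exact: nbhs_right_gt.
have tsT : t + s <= T.
  by rewrite -lerBrDl; near: s; apply: nbhs_right_le; rewrite subr_gt0.
have tts : t <= t + s by rewrite lerDl ltW.
move: xs; rewrite /defined_at/= VE// => xs.
by rewrite sum_pderiv_call_price// => i; [exact: mW|exact: iW].
Unshelve. all: by end_near. Qed.

Lemma dV_ML_value x : pdom (dV_ML S t) x -> dV_ML S t x = joint_cdf S t x - 1.
Proof. by move=> [pF _]; apply/cvg_lim => //; exact: dV_ML_cvg. Qed.

(** Requiring genericity for every window length would take an uncountable intersection. These
    countably many lengths fit into [[0, T]] and tend to 0, which is all that a proper filter for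
    the partial limit demands. *)
Definition generic_at (x : n.-tuple R) : Prop := forall k : nat,
  generic_strike Q (window_max S t (t + (T - t) / k.+1%:R)) x.

Let step_gt0 (k : nat) : 0 < (T - t) / k.+1%:R.
Proof. by rewrite divr_gt0// subr_gt0. Qed.

Let step_le (k : nat) : t + (T - t) / k.+1%:R <= T.
Proof.
rewrite -lerBrDl ler_pdivrMr// ler_peMr ?ler1n//.
by rewrite subr_ge0 ltW.
Qed.

Let mWk k i : measurable_fun setT (window_max S t (t + (T - t) / k.+1%:R) i).
Proof. by apply: mW => //; rewrite lerDl ltW. Qed.

Lemma generic_at_ae : {ae @lebesgue_tuple R n, forall x, generic_at x}.
Proof. by apply: ae_forall_nat => k; apply: generic_strike_ae. Qed.

Lemma generic_at_lines x j : generic_at x ->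
  mu.-negligible [set h | ~ generic_at (shiftc j h x)].
Proof.
move=> gx; suff : {ae mu, forall h, generic_at (shiftc j h x)} by [].
by apply: ae_forall_nat => k; apply: generic_strike_lines.
Qed.

Lemma generic_at_pdom x : generic_at x -> pdom (dV_ML S t) x.
Proof.
move=> gx.
have pF : ProperFilter (within (defined_at x) (0 : R)^'+).
  apply: Build_ProperFilter_ex => B; rewrite /within/= => wB.
  have c0 : (T - t) / k.+1%:R @[k --> \oo] --> 0.
    rewrite -(mulr0 (T - t)); apply: cvgM; first exact: cvg_cst.
    exact: cvg_harmonic.
  have : \forall s \near (0 : R)^'+, defined_at x s -> B s by exact: wB.
  rewrite near_withinE => /nbhs_ballP[e /= e0 he].
  have [N _ hN] : \forall k \near \oo, (T - t) / k.+1%:R < e by apply: (cvgr_lt 0).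
  exists ((T - t) / N.+1%:R); apply: he => //.
    by rewrite /ball/= sub0r normrN gtr0_norm//; exact: (hN N (leqnn N)).
  by move=> j; apply: generic_pdom_V_ML => //; exact: gx.
by split => //; apply/cvg_ex; exists (joint_cdf S t x - 1); exact: dV_ML_cvg.
Qed.

End look_back_derivative.

(** * Asian baskets *)

Section layer_cake.
Context d (X : measurableType d) (R : realType).
Notation mu := (@lebesgue_measure R).
Local Open Scope ereal_scope.

(** The positive part of [g] is the length of the set of [u >= 0] below [g]; Tonelli exchanges the
    two integrals. *)
Lemma layer_cake (m : {sigma_finite_measure set X -> \bar R}) (g r : X -> R) :
  measurable_fun setT g -> measurable_fun setT r -> (forall x, (0 <= r x)%R) ->
  \int[m]_x (Num.max (g x) 0 * r x)%:E =
  \int[mu]_(u in `]0%R, +oo[) \int[m]_(x in [set x | (u < g x)%R]) (r x)%:E.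
Proof.
move=> mg mr r0.
pose f (p : X * measurableTypeR R) : \bar R :=
  (if (0 < p.2)%R && (p.2 < g p.1)%R then r p.1 else 0%R)%:E.
have m2 : measurable_fun setT (fun p : X * measurableTypeR R => p.2 : R).
  exact: (@measurable_snd _ _ _ (measurableTypeR R)).
have mg1 : measurable_fun setT (fun p : X * measurableTypeR R => g p.1).
  exact: (measurableT_comp mg measurable_fst).
have mf : measurable_fun setT f.
  apply/measurable_EFinP; apply: measurable_fun_ifT => //.
    apply: measurable_and; first by apply: measurable_fun_ltr => //; exact: measurable_cst.
    exact: measurable_fun_ltr.
  exact: (measurableT_comp mr measurable_fst).
have f0 p : 0 <= f p by rewrite /f lee_fin; case: ifP.
have := @fubini_tonelli _ _ _ _ R m mu f mf f0.
have -> : \int[m]_x \int[mu]_y f (x, y) = \int[m]_x (Num.max (g x) 0 * r x)%:E.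
  apply: eq_integral => x _; rewrite /f /=.
  have -> : \int[mu]_y (if (0 < y)%R && (y < g x)%R then r x else 0%R)%:E =
      \int[mu]_(y in `]0%R, g x[) (r x)%:E.
    rewrite [RHS]integral_mkcond; apply: eq_integral => y _.
    rewrite patchE mem_setE in_itv/=; by case: ifP.
  rewrite integral_cst//=.
  rewrite lebesgue_measure_itv/= lte_fin.
  case: (ltP 0%R (g x)) => gx; first by rewrite oppr0 adde0 -EFinM mulrC.
  by rewrite mule0 mul0r.
move=> ->; rewrite [RHS]integral_mkcond; apply: eq_integral => u _.
rewrite patchE mem_setE in_itv/= andbT /f /=; case: ifPn => u0.
  rewrite [RHS]integral_mkcond; apply: eq_integral => x _.
  rewrite patchE (_ : (x \in _) = (u < g x)%R); last by apply/idP/idP; rewrite inE.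
  by case: (u < g x)%R.
exact: integral0_eq.
Qed.

End layer_cake.

Section expected_call.
Context d (Omega : measurableType d) (R : realType) (Q : probability Omega R).
Context (n : nat) (S : 'I_n -> R -> {RV Q >-> R}) (t : R) (rho : n.-tuple R -> R).
Hypothesis mrho : measurable_fun setT rho.
Hypothesis rho_ge0 : forall x, 0 <= rho x.
Hypothesis rho_law : forall A : set (n.-tuple R), measurable A ->
  (Q [set w | A (stocks S t w)] =
   \int[@lebesgue_tuple R n]_(x in A `&` @orthant R n) (rho x)%:E)%E.

(** The layer cake formula on both spaces reduces the change of variables to half-spaces, where the
    law hypothesis applies directly. *)
Lemma expected_call_density i (k : R) :
  (\int[Q]_w (Num.max (S i t w - k) 0)%:E =
   \int[@lebesgue_tuple R n]_(x in @orthant R n)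
     (Num.max (tnth x i - k) 0 * rho x)%:E)%E.
Proof.
have -> : (\int[@lebesgue_tuple R n]_(x in @orthant R n)
     (Num.max (tnth x i - k) 0 * rho x)%:E =
  \int[@lebesgue_tuple R n]_x (Num.max (tnth x i - k) 0 * rho_orthant rho x)%:E)%E.
  rewrite [LHS]integral_mkcond; apply: eq_integral => x _.
  by rewrite /rho_orthant !patchE; case: ifP; rewrite ?mulr0.
have mti : measurable_fun setT (fun x : n.-tuple R => tnth x i - k).
  by apply: measurable_funB => //; exact: measurable_tnth.
have mSi : measurable_fun setT (fun w => S i t w - k).
  by apply: measurable_funB => //; exact: measurable_funPT.
rewrite (layer_cake _ mti) //; last 2 first.
- exact: measurable_rho_orthant.
- exact: rho_orthant_ge0.
under eq_integral => w _ do rewrite -(mulr1 (Num.max _ _)).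
rewrite (@layer_cake _ _ _ Q _ (cst (1 : R)) mSi)//.
apply: eq_integral => u _.
have mA : measurable [set x : n.-tuple R | u < tnth x i - k].
  rewrite (_ : [set _ | _] = (fun x : n.-tuple R => tnth x i - k) @^-1` `]u, +oo[).
    by rewrite -[X in measurable X]setTI; apply: mti => //; exact: measurable_itv.
  by apply/seteqP; split => x /=; rewrite in_itv/= andbT.
have mB : measurable [set w | u < S i t w - k].
  rewrite (_ : [set _ | _] = (fun w => S i t w - k) @^-1` `]u, +oo[).
    by rewrite -[X in measurable X]setTI; apply: mSi => //; exact: measurable_itv.
  by apply/seteqP; split => x /=; rewrite in_itv/= andbT.
transitivity (Q [set w | u < S i t w - k]).
  by have := integral_cst Q mB 1%:E; rewrite mul1e.
rewrite -(law_rho_orthant rho_law)//.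
by congr (Q _); apply/seteqP; split => w; rewrite /= tnth_mktuple.
Qed.

End expected_call.

Section joint_measurability.
Context d (Omega : measurableType d) (R : realType) (Q : probability Omega R).
Context (X : R -> {RV Q >-> R}) (T : R).
Hypothesis X_rcont : forall w (t : R), t \in `[0, T[ -> X u w @[u --> t^'+] --> X t w.

(* The first point of the grid of mesh [1 / m.+1] to the right of [t]. *)
Let grid (m k : nat) : R := Num.min T (k.+1%:R / m.+1%:R).
Let next (m : nat) (t : R) : R := grid m (Num.truncn (t * m.+1%:R)).

Let next_gt m t : t < T -> t < next m t.
Proof. by move=> tT; rewrite lt_min tT ltr_pdivlMr// truncnS_gt. Qed.

Let next_cvg t : 0 <= t -> t < T -> next m t @[m --> \oo] --> t.
Proof.
move=> t0 tT; apply/cvgrPdist_lt => e e0; near=> m.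
have me : m.+1%:R^-1 < e by near: m; exact: (near_infty_natSinv_lt (PosNum e0)).
rewrite distrC gtr0_norm ?subr_gt0 ?next_gt// (le_lt_trans _ me)//.
rewrite lerBlDl ge_min; apply/orP; right.
rewrite ler_pdivrMr// mulrDl mulVf// -natr1 lerD2r truncn_le.
by rewrite mulr_ge0.
Unshelve. all: by end_near. Qed.

(** Right-continuity is available only on [[0, T[], so the process is set to 0 elsewhere. *)
Definition restricted_process (p : measurableTypeR R * Omega) : R :=
  if (0 <= p.1) && (p.1 < T) then X p.1 p.2 else 0.

(** The process is the pointwise limit of the step processes [h m]. On each cell of the grid [h m]
    depends on [w] alone, so its preimages are countable unions of rectangles. *)
Lemma measurable_restricted_process : measurable_fun setT restricted_process.
Proof.
pose h (m : nat) (p : measurableTypeR R * Omega) : R :=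
  if (0 <= p.1) && (p.1 < T) then X (next m p.1) p.2 else 0.
apply: (@measurable_fun_cvg _ _ _ setT h); last first.
  move=> [t w] _; rewrite /h /restricted_process/=; case: ifPn => [/andP[t0 tT]|_].
    (* A limit from the right only sees times strictly after [t], which is why [next] never returns
       [t] itself. *)
    have /cvg_at_rightP := @X_rcont w t ltac:(by rewrite in_itv/= t0 tT).
    by apply; split; [move=> m; exact: next_gt|exact: next_cvg].
  exact: cvg_cst.
move=> m _ Y mY; rewrite setTI.
pose cell k : set (measurableTypeR R) :=
  `[0, T[ `&` [set t | k%:R <= t * m.+1%:R < k.+1%:R].
have cellE k : cell k = `[0, T[%classic `&` `[k%:R / m.+1%:R, k.+1%:R / m.+1%:R[%classic.
  rewrite /cell; congr setI; apply/seteqP; split => t /=; rewrite in_itv/=;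
  by rewrite ler_pdivrMr// ltr_pdivlMr.
have -> : h m @^-1` Y = \bigcup_k (cell k `*` (X (grid m k) @^-1` Y)) `|`
    ((~` `[0, T[) `*` (fun=> 0) @^-1` Y).
  apply/seteqP; split => -[t w]; rewrite /h/=.
    case: ifPn => [tT Yh|ntT Y0]; last first.
      by right; split => //=; rewrite in_itv/=; exact/negP.
    left; exists (Num.truncn (t * m.+1%:R)) => //; split => //=.
    rewrite /cell/= in_itv/= tT; split => //.
    by rewrite -truncn_eq ?eqxx// mulr_ge0//; case/andP: tT.
  case=> [[k _ [/= []]]|[/= nt Y0]]; last by rewrite in_itv/= in nt; rewrite ifF//; exact/negP.
  move=> /= + tk Yk; rewrite in_itv/= => tT; rewrite tT /next.
  by rewrite (truncn_def tk).
apply: measurableU.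
  apply: bigcupT_measurable => k; apply: measurableX.
    by rewrite cellE; apply: measurableI; exact: measurable_itv.
  by apply: measurable_funPTI.
apply: measurableX; first by apply: measurableC; exact: measurable_itv.
by rewrite -[X in measurable X]setTI; exact: measurable_cst.
Qed.

End joint_measurability.

(** * The pricing formula when all paths are regular *)

Section regular_market.
Context d (Omega : measurableType d) (R : realType) (Q : probability Omega R).
Context (n : nat) (S : 'I_n -> R -> {RV Q >-> R}) (T : R).
Hypothesis n_gt0 : (0 < n)%N.
Hypothesis T_gt0 : 0 < T.
Hypothesis S_gt0 : forall i (t : R) w, t \in `[0, T] -> 0 < S i t w.
Hypothesis S_rcont : forall w i (t : R), t \in `[0, T[ -> S i u w @[u --> t^'+] --> S i t w.
Hypothesis S_max : forall i w, exists2 t : R, t \in `[0, T] &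
  forall u : R, u \in `[0, T] -> S i u w <= S i t w.
Hypothesis S_max_fin : forall i, ('E_Q[running_max S T i] < +oo)%E.
Notation mu := (@lebesgue_measure R).

(** Time [T] is left out because joint measurability is known on [[0, T[]; a single time does not
    affect the integrals. *)
Let call (K : n.-tuple R) i (p : measurableTypeR R * Omega) : R :=
  if (0 <= p.1) && (p.1 < T) then Num.max (S i p.1 p.2 - tnth K i) 0 else 0.

Let call_ge0 K i p : 0 <= call K i p.
Proof. by rewrite /call; case: ifP => // _; rewrite le_max lexx orbT. Qed.

Let measurable_call K i : measurable_fun setT (call K i).
Proof.
have m1 : measurable_fun setT (fun p : measurableTypeR R * Omega => p.1 : R).
  exact: (@measurable_fst _ _ (measurableTypeR R)).
rewrite (_ : call K i = fun p => if (0 <= p.1) && (p.1 < T) then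
    Num.max (restricted_process (S i) T p - tnth K i) 0 else 0).
  apply: measurable_fun_ifT => //.
    apply: measurable_and; first by apply: measurable_fun_ler => //; exact: measurable_cst.
    by apply: measurable_fun_ltr => //; exact: measurable_cst.
  apply: measurable_maxr => //; apply: measurable_funB => //.
  by apply: measurable_restricted_process => w t; exact: S_rcont.
by apply/funext => p; rewrite /call /restricted_process; case: ifP.
Qed.

Let ae_neq : {ae mu, forall t, t != T}.
Proof.
exists [set T]; split => //; first exact: lebesgue_measure_set1.
by move=> v /= /negP /negPn /eqP ->.
Qed.

(** The payoff is the [fine] part of a path integral, so the identity needs that integral to be
    finite; the maxima of the stocks over [[0, T]] bound it. *)
Let f_AB_call K w :
  (f_AB S T K w)%:E = (\int[mu]_t \sum_(i < n) (call K i (t, w))%:E)%E.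
Proof.
have E : (\int[mu]_(t in `[0%R, T])
      (\sum_(i < n) Num.max (S i t w - tnth K i) 0)%:E =
    \int[mu]_t \sum_(i < n) (call K i (t, w))%:E)%E.
  rewrite integral_mkcond; apply: ae_eq_integral_nomeas; apply: aeS ae_neq => t tT _.
  rewrite patchE mem_setE in_itv/= sumEFin /call/= (le_eqVlt t) (negbTE tT)/=.
  by case: ifP => // _; rewrite big1.
rewrite /f_AB /Rintegral E fineK// ge0_fin_numE; last first.
  by apply: integral_ge0 => t _; apply: sume_ge0 => i _; rewrite lee_fin.
apply: (@le_lt_trans _ _ (\int[mu]_(t in `[0%R, T]) (cst (\sum_(i < n)
    (window_max S 0 T i w + `|tnth K i|))%:E t))%E); last first.
  rewrite integral_cst//= lebesgue_measure_itv/= lte_fin T_gt0 -EFinB -EFinM.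
  exact: ltry.
rewrite [leRHS]integral_mkcond; apply: ge0_le_integral => //.
- by move=> t _; apply: sume_ge0 => i _; rewrite lee_fin.
- apply: emeasurable_sum => i; apply/measurable_EFinP.
  exact: (measurableT_comp (@measurable_call K i) (pair2_measurable w)).
- apply/(measurable_restrictT _ _).1 => //; exact: measurable_cst.
move=> t _; rewrite patchE mem_setE in_itv/= sumEFin; case: ifPn => tT.
  rewrite lee_fin; apply: ler_sum => i _; rewrite /call; case: ifP => _.
    rewrite ge_max; apply/andP; split.
      apply: lerD; first by apply: (le_window_max S_max) => //; rewrite in_itv.
      by rewrite -normrN ler_norm.
    rewrite addr_ge0//; apply: (window_max_ge0 S_gt0 S_max) => //; exact: ltW.
  rewrite addr_ge0//; apply: (window_max_ge0 S_gt0 S_max) => //; exact: ltW.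
rewrite big1// => i _; rewrite /call/= ifF//; apply/negP => /andP[t0 tltT].
by move: tT; rewrite t0 ltW.
Qed.

Lemma V_AB_tonelli K : V_AB S T K =
  (\sum_(i < n) \int[mu]_(t in `[0%R, T])
     \int[Q]_w (Num.max (S i t w - tnth K i) 0)%:E)%E.
Proof.
have mc i : measurable_fun setT (EFin \o call K i) by apply/measurable_EFinP.
have c0 i p : (0 <= (EFin \o call K i) p)%E by rewrite lee_fin.
rewrite /V_AB unlock; under eq_integral => w _ do rewrite f_AB_call.
transitivity (\int[Q]_w \sum_(i < n) \int[mu]_t (call K i (t, w))%:E)%E.
  apply: eq_integral => w _; rewrite ge0_integral_sum//.
    move=> i; apply/measurable_EFinP.
    exact: (measurableT_comp (@measurable_call K i) (pair2_measurable w)).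
  by move=> i t _; rewrite lee_fin.
rewrite ge0_integral_sum//; last 2 first.
- by move=> i; exact: (measurable_fun_fubini_tonelli_G _ (mc i) (c0 i)).
- by move=> i w _; apply: integral_ge0 => t _; rewrite lee_fin.
apply: eq_bigr => i _.
rewrite -(@fubini_tonelli _ _ _ _ R mu Q _ (mc i) (c0 i)) [RHS]integral_mkcond.
apply: ae_eq_integral_nomeas; apply: aeS ae_neq => t tT _.
rewrite patchE mem_setE in_itv/= (le_eqVlt t) (negbTE tT)/= /call/=.
case: ifPn => tT0; last exact: integral0.
by apply: eq_integral => w _.
Qed.

Lemma mixed_dV_ML (t : R) (rho : n.-tuple R -> R) : 0 <= t -> t < T ->
  measurable_fun setT rho -> (forall x, 0 <= rho x) ->
  (forall A : set (n.-tuple R), measurable A ->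
     Q [set w | A (stocks S t w)] =
     \int[@lebesgue_tuple R n]_(x in A `&` @orthant R n) (rho x)%:E)%E ->
  {ae @lebesgue_tuple R n, forall x, orthant x ->
     [/\ pdom (dV_ML S t) x, pdom (mixed_pderiv (dV_ML S t)) x &
         mixed_pderiv (dV_ML S t) x = rho x]}.
Proof.
move=> t0 tT mrho rho0 law.
have no_atom := stock_no_atom law.
have Edom := generic_at_pdom n_gt0 T_gt0 S_gt0 S_rcont S_max S_max_fin t0 tT no_atom.
have Elines := generic_at_lines S_rcont S_max t0 tT.
(* The constant [- 1] is the one in [dV_ML_value]: the limit is the distribution function minus
   1. *)
have := @mixed_pderiv_of_density R n (rho_orthant rho) (dV_ML S t) (- 1)
  (generic_at S T t) n_gt0.
move=> /(_ (measurable_rho_orthant mrho) (rho_orthant_ge0 rho0)).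
move=> /(_ (integrable_rho_orthant mrho rho0 law)) /(_ _)/wrap[|].
  move=> x xdom; rewrite -(joint_cdf_density law).
  exact: (dV_ML_value n_gt0 T_gt0 S_gt0 S_rcont S_max S_max_fin t0 tT no_atom).
move=> /(_ Edom Elines).
have := generic_at_ae S_rcont S_max t0 tT.
apply: aeS2 => x Ex [h1 h2] ox; split; [exact: Edom|exact: h2|].
by rewrite (h1 (h2 Ex)) /rho_orthant patchE mem_set.
Qed.

Lemma V_AB_regular K :
  {ae mu, forall t, t \in `[0, T] -> exists rho : n.-tuple R -> R,
    [/\ measurable_fun setT rho, (forall x, 0 <= rho x) &
        (forall A : set (n.-tuple R), measurable A ->
           Q [set w | A (stocks S t w)] =
           \int[@lebesgue_tuple R n]_(x in A `&` @orthant R n) (rho x)%:E)%E]} ->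
  V_AB S T K =
    (\sum_(i < n)
       \int[mu]_(t in `[0%R, T])
         \int[@lebesgue_tuple R n]_(x in @orthant R n)
           (Num.max (tnth x i - tnth K i) 0 * mixed_pderiv (dV_ML S t) x)%:E)%E.
Proof.
move=> law; rewrite V_AB_tonelli; apply: eq_bigr => i _.
apply: ae_eq_integral_nomeas; apply: aeS2 law ae_neq => t law tT tin.
have [rho [mrho rho0 rholaw]] := law tin.
have /andP[t0 tltT] : 0 <= t < T by move: tin; rewrite /= in_itv/= lt_neqAle tT.
rewrite (expected_call_density mrho rho0 rholaw); apply: ae_eq_integral_nomeas.
apply: aeS (mixed_dV_ML t0 tltT mrho rho0 rholaw) => x h ox.
by have [_ _ ->] := h ox.
Qed.

End regular_market.

(** * From almost surely regular paths to paths that are always regular *)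

Lemma probability_eq_off_null d (Omega : measurableType d) (R : realType)
    (Q : probability Omega R) (N A B : set Omega) :
  measurable N -> Q N = 0%E -> measurable A -> measurable B ->
  (forall w, ~ N w -> A w <-> B w) -> Q A = Q B.
Proof.
move=> mN N0 mA mB AB; rewrite -[A]setIT -[B]setIT -!integral_indic//.
apply: ae_eq_integral_nomeas; exists N; split => // w /=; apply: contra_notP => nN _.
congr EFin; rewrite !indicE; congr (nat_of_bool _)%:R.
by apply/idP/idP; rewrite !inE => /(AB w nN).
Qed.

Theorem theorem2p5 (R : realType) (d : measure_display)
    (Omega : measurableType d) (Q : probability Omega R)
    (n : nat) (n_gt0 : (0 < n)%N) (T : R) (T_gt0 : 0 < T)
    (S : 'I_n -> R -> {RV Q >-> R})
    (S_gt0 : forall i t w, t \in `[0, T] -> 0 < S i t w)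
    (S_rcont : {ae Q, forall w, forall i t, t \in `[0, T[ ->
                 S i u w @[u --> t^'+] --> S i t w})
    (S_max : forall i, {ae Q, forall w, exists2 t, t \in `[0, T] &
               forall u, u \in `[0, T] -> S i u w <= S i t w})
    (S_max_fin : forall i, ('E_Q[running_max S T i] < +oo)%E)
    (S_density : {ae @lebesgue_measure R, forall t, t \in `[0, T] ->
                   has_cdf_density S t})
    (K : n.-tuple R) :
  [/\ (forall t s, 0 <= t -> 0 < s -> t + s <= T ->
         {ae @lebesgue_tuple R n, forall x, orthant x ->
            forall j, pdom (pderiv j (ptotal (V_ML S t (t + s)))) x}),
      {ae @lebesgue_measure R, forall t, t \in `[0, T] ->
         {ae @lebesgue_tuple R n, forall x, orthant x ->
            pdom (dV_ML S t) x /\ pdom (mixed_pderiv (dV_ML S t)) x}}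
    & V_AB S T K =
      (\sum_(i < n)
         \int[@lebesgue_measure R]_(t in `[0%R, T])
           \int[@lebesgue_tuple R n]_(x in @orthant R n)
             (Num.max (tnth x i - tnth K i) 0 *
              mixed_pderiv (dV_ML S t) x)%:E)%E].
Proof.
have [N [mN N0 HN]] : {ae Q, forall w, (forall i (t : R), t \in `[0, T[ ->
      S i u w @[u --> t^'+] --> S i t w) /\
    (forall i, exists2 t : R, t \in `[0, T] &
       forall u : R, u \in `[0, T] -> S i u w <= S i t w)}.
  apply: aeS2 S_rcont (ae_forall_countType S_max) => w h1 h2.
  by split.
have {}HN w : ~ N w -> (forall i (t : R), t \in `[0, T[ ->
      S i u w @[u --> t^'+] --> S i t w) /\
    (forall i, exists2 t : R, t \in `[0, T] &
       forall u : R, u \in `[0, T] -> S i u w <= S i t w).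
  by move=> nN; apply: contrapT => /HN.
(* On the null event the prices are frozen at 1: constant positive paths are right-continuous and
   attain their maximum. *)
pose f i (t : R) w : R := if w \in N then 1 else S i t w.
have mf i t : measurable_fun setT (f i t).
  rewrite (_ : f i t = (fun w => \1_N w + \1_(~` N) w * S i t w)).
    apply: measurable_funD; first exact: measurable_indic.
    apply: measurable_funM; first by apply: measurable_indic; exact: measurableC.
    exact: measurable_funPT.
  apply/funext => w; rewrite /f !indicE in_setC.
  by case: (w \in N); rewrite /= ?mul0r ?addr0 ?add0r ?mul1r.
pose S' i t : {RV Q >-> R} :=
  HB.pack (f i t) (isMeasurableFun.Build _ _ _ _ (f i t) (mf i t)).
have S'E w i t : ~ N w -> S' i t w = S i t w by move=> nN; rewrite /= /f memNset.
have S'N w i t : N w -> S' i t w = 1 by move=> Nw; rewrite /= /f mem_set.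
have S'_gt0 i (t : R) w : t \in `[0, T] -> 0 < S' i t w.
  by move=> tT; rewrite /= /f; case: ifP => // _; exact: S_gt0.
have S'_rcont w i (t : R) : t \in `[0, T[ -> S' i u w @[u --> t^'+] --> S' i t w.
  move=> tT; have [Nw|nN] := pselect (N w).
    rewrite (_ : (fun u => S' i u w) = cst (S' i t w)); first exact: cvg_cst.
    by apply/funext => u; rewrite !S'N.
  rewrite (_ : (fun u => S' i u w) = (fun u => S i u w)); last first.
    by apply/funext => u; exact: S'E.
  by rewrite S'E//; exact: (HN w nN).1.
have S'_max i w : exists2 t : R, t \in `[0, T] &
    forall u : R, u \in `[0, T] -> S' i u w <= S' i t w.
  have [Nw|nN] := pselect (N w).
    exists 0; first by rewrite in_itv/= lexx ltW.
    by move=> u _; rewrite !S'N.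
  have [t tT tmax] := (HN w nN).2 i.
  by exists t => // u uT; rewrite !S'E//; exact: tmax.
(* Prices are expectations and cannot see the null event, whatever the measurability of the
   payoffs. *)
have off (g g' : Omega -> R) : (forall w, ~ N w -> g w = g' w) ->
    ('E_Q[g] = 'E_Q[g'])%E.
  move=> gg; rewrite unlock; apply: ae_eq_integral_nomeas.
  by exists N; split => // w /=; apply: contra_notP => nN _; rewrite gg.
have S'_max_fin i : ('E_Q[running_max S' T i] < +oo)%E.
  rewrite (off _ (running_max S T i))// => w nN; congr sup.
  by apply/seteqP; split => _ [t tT <-]; exists t => //; rewrite S'E.
have VE a b : V_ML S' a b = V_ML S a b.
  apply/funext => x; congr fine; apply: off => w nN; congr sup.
  apply/seteqP; split => y [i [t [tab ->]]]; exists i, t; split => //.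
    by rewrite S'E.
  by rewrite S'E.
have dVE t : dV_ML S' t = dV_ML S t.
  by rewrite /dV_ML; congr plim; apply/funext => s; rewrite VE.
have VABE : V_AB S' T K = V_AB S T K.
  apply: off => w nN; apply: eq_Rintegral => t _.
  by apply: eq_bigr => i _; rewrite S'E.
have law : {ae @lebesgue_measure R, forall t, t \in `[0, T] ->
    exists rho : n.-tuple R -> R,
    [/\ measurable_fun setT rho, (forall x, 0 <= rho x),
        (forall A : set (n.-tuple R), measurable A ->
           Q [set w | A (stocks S' t w)] =
           \int[@lebesgue_tuple R n]_(x in A `&` @orthant R n) (rho x)%:E)%E &
        has_cdf_density S t]}.
  apply: aeS S_density => t h tT; have dens := h tT.
  have [rho [mrho rho0 rholaw _]] := dens; exists rho; split => // A mA.
  rewrite -rholaw//; apply: (probability_eq_off_null mN N0).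
  - by rewrite -[X in measurable X]setTI; exact: measurable_stocks.
  - by rewrite -[X in measurable X]setTI; exact: measurable_stocks.
  move=> w nN; rewrite /= (_ : stocks S' t w = stocks S t w)//.
  by apply: eq_from_tnth => i; rewrite !tnth_mktuple S'E.
split.
- move=> t s t0 s0 tsT.
  have tts : t <= t + s by rewrite lerDl ltW.
  have := @generic_strike_ae _ _ _ Q n (window_max S' t (t + s))
    (fun i => measurable_window_max S'_rcont S'_max i t0 tts tsT).
  apply: aeS => x gx _ j; rewrite -VE.
  exact: (generic_pdom_V_ML n_gt0 T_gt0 S'_gt0 S'_rcont S'_max S'_max_fin).
(* At [t = T] no window to the right fits into [[0, T]]; this one time is discarded. *)
- have ae_neq : {ae @lebesgue_measure R, forall t, t != T}.
    exists [set T]; split => //; first exact: lebesgue_measure_set1.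
    by move=> v /= /negP /negPn /eqP ->.
  apply: aeS2 law ae_neq => t h tT tin.
  have [rho [mrho rho0 rholaw _]] := h tin.
  have /andP[t0 tltT] : 0 <= t < T by move: tin; rewrite /= in_itv/= lt_neqAle tT.
  have := mixed_dV_ML n_gt0 T_gt0 S'_gt0 S'_rcont S'_max S'_max_fin t0 tltT mrho rho0 rholaw.
  by rewrite dVE; apply: aeS => x hx /hx [].
- rewrite -VABE (V_AB_regular n_gt0 T_gt0 S'_gt0 S'_rcont S'_max S'_max_fin).
    by apply: eq_bigr => i _; apply: eq_integral => t _; rewrite dVE.
  apply: aeS law => t h tin; have [rho [h1 h2 h3 _]] := h tin.
  by exists rho.
Qed.
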